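(* Let $F_2=\langle a,b\rangle$ be the free group of rank two. In (1)–(4) below let $l>0$, let $p_i,q_i$ ($1\le i\le l$) be nonzero integers, and take indices modulo $l$. The following words in $F_2$ are polygonal. (1) $w=\prod_{i=1}^l a^{p_i}b^{q_i}$ where $|p_i|>1$ and $|q_i|>1$ for each $i$. (2) $w=\prod_{i=1}^l a^{p_i}b^{q_i}$ where $|p_i|>1$ and $|q_i|=1$ for each $i$, and $\sum_{i=1}^l (\operatorname{sign}(p_i q_i)+\operatorname{sign}(p_{i+1}q_i))=0$. (3) $w=\prod_{i=1}^l a^{p_{i}} (a^{q_i})^b$ where $|p_i|>1$ and $|q_i|>1$ for each $i$. (4) A simple height-one word $w=\prod_{i=1}^l a^{p_i} (a^{q_i})^b$ (i.e. all $p_i$ have the same sign and all $q_i$ have the same sign) such that $pp'\le q^2$ and $qq'\le p^2$, where $p=\sum_i |p_i|$, $q=\sum_i |q_i|$, $p'=|\{i : |p_i|=1\}|$ and $q'=|\{i: |q_i|=1\}|$.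
   Context: Notation: $u^v=v^{-1}uv$, so $(a^{q})^b=b^{-1}a^{q}b$. Polygonality. Let $F$ be the free group on $a_1,\dots,a_n$ ($n>1$; for $n=2$ the generators are written $a,b$), and let $R$ be the bouquet of $n$ oriented circles labeled $a_1,\dots,a_n$, so that $\pi_1(R)=F$. A graph is a 1-dimensional CW-complex; a graph map sends vertices to vertices and edges to edges; an immersion is a locally injective graph map. An immersion from a graph to $R$ induces an orientation and a label on each edge of the graph. A polygonal disk $P$ is a 2-disk whose boundary $\partial P$ has the CW-structure of a polygon. A side-pairing $\sim$ on polygonal disks $P_1,\dots,P_m$ is an equivalence relation on the set of all edges of $\coprod_i\partial P_i$ with every class of size exactly two, together with a choice of homeomorphism between the edges in each class. Then $S=\coprod_i P_i/\!\sim$ is a closed surface with a CW-structure having $m(S)=m$ two-cells. For a cyclically reduced word $w\in F$, $S$ is a closed $w$-polygonal surface if there is an immersion $\phi\colon S^{(1)}\to R$ such that for every $i$ the composition $\partial P_i\to S^{(1)}\to R$ is an immersion reading (from a suitable starting vertex and in a suitable direction) a non-zero power of $w$. The word $w$ is polygonal if there exists a closed $w$-polygonal surface $S$ with $\chi(S)<m(S)$. *)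

(* Defs.v *)
From HB Require Import structures.
From mathcomp Require Import all_boot all_order all_algebra.
Set Implicit Arguments.
Unset Strict Implicit.
Unset Printing Implicit Defensive.

Local Open Scope quotient_scope.

(* [(i, true)] is the generator [a_i] and [(i, false)] is its inverse. *)
Notation letter n := ('I_n * bool)%type.

Definition linv n (x : letter n) : letter n := (x.1, ~~ x.2).

Lemma linvK n : involutive (@linv n).
Proof. by case=> i b; rewrite /linv /= negbK. Qed.

Lemma linv_neq n (x : letter n) : linv x != x.
Proof. by case: x => i []; rewrite /linv xpair_eqE andbF. Qed.

Definition nocancel n : rel (letter n) := fun x y => y != linv x.

Definition reduced n (u : seq (letter n)) : bool := sorted (@nocancel n) u.

Record freegroup (n : nat) :=
  FreeGroup { fgval :> seq (letter n); fgvalP : reduced fgval }.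
HB.instance Definition _ n := [isSub for @fgval n].
HB.instance Definition _ n := [Countable of freegroup n by <:].

Section FreeGroupLaw.
Variable n : nat.
Implicit Types (x : letter n) (u v : seq (letter n)).

Definition push x u : seq (letter n) :=
  if u is y :: u' then if y == linv x then u' else x :: u else [:: x].

Definition wmul u v : seq (letter n) := foldr push v u.

Definition winv u : seq (letter n) := rev (map (@linv n) u).

Lemma reduced_push x u : reduced u -> reduced (push x u).
Proof.
case: u => // y u; rewrite /push; case: ifPn => [_|yx] /=; first exact: path_sorted.
by move=> ->; rewrite /nocancel yx.
Qed.

Lemma reduced_wmul u v : reduced v -> reduced (wmul u v).
Proof. by move=> rv; elim: u => //= x u; apply: reduced_push. Qed.

Lemma reduced_winv u : reduced u -> reduced (winv u).
Proof.
rewrite /reduced /winv rev_sorted sorted_map.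
by apply: sub_sorted => x y /=; rewrite /nocancel /= linvK eq_sym => /negbTE ->.
Qed.

Lemma pushK x u : reduced u -> push (linv x) (push x u) = u.
Proof.
case: u => [|y u] /=; first by rewrite linvK eqxx.
case: ifPn => [/eqP-> | _] /=; last by rewrite linvK eqxx.
case: u => //= z u /andP[]; rewrite /nocancel => /negbTE ->.
by [].
Qed.

Lemma wmul_push x u v : reduced u -> reduced v ->
  wmul (push x u) v = push x (wmul u v).
Proof.
case: u => //= y u ru rv; case: ifPn => //= /eqP ->.
by rewrite -[X in push X (push _ _)]linvK pushK // reduced_wmul.
Qed.

Lemma wmulA u v w : reduced u -> reduced v -> reduced w ->
  wmul u (wmul v w) = wmul (wmul u v) w.
Proof.
move=> + rv rw; elim: u => //= x u IHu /path_sorted ru.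
by rewrite IHu // wmul_push // reduced_wmul.
Qed.

Lemma wmul1 u : reduced u -> wmul u [::] = u.
Proof.
elim: u => //= x u IHu ru; rewrite (IHu (path_sorted ru)).
by case: u ru {IHu} => //= y u /andP[]; rewrite /nocancel => /negbTE ->.
Qed.

Lemma wmul_cat u v w : wmul (u ++ v) w = wmul u (wmul v w).
Proof. exact: foldr_cat. Qed.

Lemma wmulVw u w : reduced w -> wmul (winv u) (wmul u w) = w.
Proof.
move=> rw; elim: u => //= x u IHu.
rewrite /winv map_cons rev_cons -cats1 wmul_cat /= pushK ?reduced_wmul //.
Qed.

Lemma winvK u : winv (winv u) = u.
Proof.
by rewrite /winv map_rev revK -map_comp map_id_in // => x _ /=; rewrite linvK.
Qed.

Implicit Types f g h : freegroup n.

Definition fgone : freegroup n := @FreeGroup n [::] isT.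
Definition fgmul f g : freegroup n := FreeGroup (reduced_wmul f (fgvalP g)).
Definition fginv f : freegroup n := FreeGroup (reduced_winv (fgvalP f)).

Lemma fgmulA : associative fgmul.
Proof. by move=> f g h; apply: val_inj; rewrite /= wmulA ?fgvalP. Qed.

Lemma fgmul1g : left_id fgone fgmul.
Proof. by move=> f; apply: val_inj. Qed.

Lemma fgmulg1 : right_id fgone fgmul.
Proof. by move=> f; apply: val_inj; rewrite /= wmul1 ?fgvalP. Qed.

Lemma fgmulVg : left_inverse fgone fginv fgmul.
Proof.
move=> f; apply: val_inj => /=.
by rewrite -[X in wmul _ X](wmul1 (fgvalP f)) wmulVw.
Qed.

Lemma fgmulgV : right_inverse fgone fginv fgmul.
Proof.
move=> f; apply: val_inj => /=; rewrite -[X in wmul X _]winvK.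
by rewrite -[X in wmul _ X](wmul1 (reduced_winv (fgvalP f))) wmulVw.
Qed.

HB.instance Definition _ := isGroup.Build (freegroup n)
  fgmulA fgmul1g fgmulg1 fgmulVg fgmulgV.

Definition gen (i : 'I_n) : freegroup n := @FreeGroup n [:: (i, true)] isT.

(* [cycle] also compares the last letter with the first one. *)
Definition cyclically_reduced f : bool := cycle (@nocancel n) f.

End FreeGroupLaw.

Definition zpow (G : groupType) (x : G) (z : int) : G :=
  match z with
  | Posz k => (x ^+ k)%g
  | Negz k => (x ^- k.+1)%g
  end.

(* Finite 1-dimensional CW-complexes, as graphs in the sense of Serre: each
   edge gives two mutually inverse oriented edges, called darts. *)
Record graph := Graph {
  vert : finType;
  dart : finType;
  src : dart -> vert;
  dinv : dart -> dart;
  dinvK : involutive dinv;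
  dinv_neq : forall d, dinv d != d
}.

Definition nedges (G : graph) : nat := #|dart G|./2.

Record graph_map (G H : graph) := GraphMap {
  gm_vert : vert G -> vert H;
  gm_dart : dart G -> dart H;
  gm_src : forall d, src (gm_dart d) = gm_vert (src d);
  gm_inv : forall d, gm_dart (dinv d) = dinv (gm_dart d)
}.

Definition gm_comp (G H K : graph) (g : graph_map H K) (f : graph_map G H) :
  graph_map G K.
Proof.
exists (gm_vert g \o gm_vert f) (gm_dart g \o gm_dart f) => d /=.
  by rewrite !gm_src.
by rewrite !gm_inv.
Defined.

(* Local injectivity, i.e. injectivity on the darts issued from each vertex. *)
Definition immersion (G H : graph) (f : graph_map G H) : Prop :=
  forall d d' : dart G, src d = src d' -> gm_dart f d = gm_dart f d' -> d = d'.

Definition rose (n : nat) : graph :=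
  @Graph unit (letter n) (fun _ => tt) (@linv n) (@linvK n) (@linv_neq n).

(* The side [j] of a [k]-gon goes from the corner [j] to the corner [j + 1];
   the boolean of a dart is [true] for this direction. *)
Section Cycle.
Variable k : nat.

Definition csrc (d : 'I_k * bool) : 'I_k := if d.2 then d.1 else ordS d.1.
Definition cinv (d : 'I_k * bool) : 'I_k * bool := (d.1, ~~ d.2).

Lemma cinvK : involutive cinv.
Proof. by case=> i b; rewrite /cinv /= negbK. Qed.

Lemma cinv_neq d : cinv d != d.
Proof. by case: d => i []; rewrite /cinv xpair_eqE andbF. Qed.

Definition cycle_graph : graph := Graph csrc cinvK cinv_neq.

End Cycle.

(* An equivalence relation with all classes of size two is a fixed-point free
   involution. Up to isotopy, the homeomorphism between the sides [s] and
   [mate s] is determined by whether it preserves ([same s = true]) or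
   reverses the directions given by the boundaries of the polygons. *)
Record side_pairing := SidePairing {
  npoly : nat;
  nside : 'I_npoly -> nat;
  nside_gt0 : forall i, 0 < nside i;
  mate : {i : 'I_npoly & 'I_(nside i)} -> {i : 'I_npoly & 'I_(nside i)};
  same : {i : 'I_npoly & 'I_(nside i)} -> bool;
  mateK : involutive mate;
  mate_neq : forall s, mate s != s;
  same_mate : forall s, same (mate s) = same s
}.

Section Skeleton.
Variable S : side_pairing.

Definition side : finType := {i : 'I_(npoly S) & 'I_(nside i)}.
Definition pdart : finType := (side * bool)%type.

Definition pnext (s : side) : side :=
  Tagged (fun i => 'I_(nside i)) (ordS (tagged s)).
(* The corner [j] of a polygon is represented by the side which starts at it. *)
Definition psrc (d : pdart) : side := if d.2 then d.1 else pnext d.1.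
Definition pinv (d : pdart) : pdart := (d.1, ~~ d.2).
Definition glue (d : pdart) : pdart :=
  (mate d.1, if same d.1 then d.2 else ~~ d.2).

Lemma glueK : involutive glue.
Proof.
by case=> s b; rewrite /glue /= mateK same_mate; case: (same s); rewrite ?negbK.
Qed.

Lemma glue_inv d : glue (pinv d) = pinv (glue d).
Proof. by case: d => s b; rewrite /glue /pinv /=; case: (same s). Qed.

Definition glued : rel pdart := fun d d' => (d' == d) || (d' == glue d).

Lemma glued_refl : reflexive glued.
Proof. by move=> d; rewrite /glued eqxx. Qed.

Lemma glued_sym : symmetric glued.
Proof.
by move=> d d'; rewrite /glued eq_sym -(inv_eq glueK d d') [glue d == _]eq_sym.
Qed.

Lemma glued_trans : transitive glued.
Proof.
move=> d2 d1 d3; rewrite /glued => /orP[]/eqP-> /orP[]/eqP->;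
  by rewrite ?glueK ?eqxx ?orbT.
Qed.

Canonical glued_equiv := EquivRel glued glued_refl glued_sym glued_trans.

Definition corner_adj : rel side :=
  fun c c' => [exists d, (psrc d == c) && (psrc (glue d) == c')].

Lemma corner_adj_sym : symmetric corner_adj.
Proof.
suff H c c' : corner_adj c c' -> corner_adj c' c.
  by move=> c c'; apply/idP/idP; apply: H.
case/existsP=> d /andP[dc dc']; apply/existsP; exists (glue d).
by rewrite glueK dc dc'.
Qed.

Definition same_vertex : rel side := connect corner_adj.

Lemma same_vertex_sym : symmetric same_vertex.
Proof. exact/sym_connect_sym/corner_adj_sym. Qed.

Canonical same_vertex_equiv := EquivRel same_vertex
  (@connect0 _ corner_adj) same_vertex_sym (@connect_trans _ corner_adj).

Definition sk_vert : Type := {eq_quot same_vertex_equiv}.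
HB.instance Definition _ := EqQuotient.on sk_vert.
HB.instance Definition _ := Choice.on sk_vert.
HB.instance Definition _ := isCountable.Build sk_vert
  (pcan_pickleK (can_pcan (@reprK _ sk_vert))).
HB.instance Definition _ := isFinite.Build sk_vert
  (pcan_enumP (can_pcan (@reprK _ sk_vert))).

Definition sk_dart : Type := {eq_quot glued_equiv}.
HB.instance Definition _ := EqQuotient.on sk_dart.
HB.instance Definition _ := Choice.on sk_dart.
HB.instance Definition _ := isCountable.Build sk_dart
  (pcan_pickleK (can_pcan (@reprK _ sk_dart))).
HB.instance Definition _ := isFinite.Build sk_dart
  (pcan_enumP (can_pcan (@reprK _ sk_dart))).

Definition sk_src (d : sk_dart) : sk_vert := \pi_sk_vert (psrc (repr d)).
Definition sk_inv (d : sk_dart) : sk_dart := \pi_sk_dart (pinv (repr d)).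

Lemma sk_src_pi d : sk_src (\pi_sk_dart d) = \pi_sk_vert (psrc d).
Proof.
rewrite /sk_src; apply/eqmodP => /=.
have /eqmodP/= : repr (\pi_sk_dart d) = d %[mod sk_dart] by rewrite reprK.
move: (repr _) => e; rewrite /glued => /orP[]/eqP->; first exact: connect0.
by apply/connect1/existsP; exists e; rewrite !eqxx.
Qed.

Lemma sk_inv_pi d : sk_inv (\pi_sk_dart d) = \pi_sk_dart (pinv d).
Proof.
rewrite /sk_inv; apply/eqmodP => /=.
have /eqmodP/= : repr (\pi_sk_dart d) = d %[mod sk_dart] by rewrite reprK.
by move: (repr _) => e; rewrite /glued => /orP[]/eqP->;
  rewrite ?glue_inv eqxx ?orbT.
Qed.

Lemma pinvK : involutive pinv.
Proof. by case=> s b; rewrite /pinv /= negbK. Qed.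

Lemma sk_invK : involutive sk_inv.
Proof. by move=> d; rewrite {2}/sk_inv sk_inv_pi pinvK reprK. Qed.

Lemma sk_inv_neq d : sk_inv d != d.
Proof.
rewrite -[X in _ != X]reprK /sk_inv eqmodE /= /glued; case: (repr d) => s b.
rewrite /glue /pinv !xpair_eqE /= eqxx /= [s == _]eq_sym (negbTE (mate_neq s)).
by case: b.
Qed.

Definition skeleton : graph := Graph sk_src sk_invK sk_inv_neq.

Definition euler_char : int :=
  (#|vert skeleton|%:Z - (nedges skeleton)%:Z + (npoly S)%:Z)%R.

Definition corner_of (i : 'I_(npoly S)) (j : 'I_(nside i)) : side :=
  Tagged (fun i => 'I_(nside i)) j.

Definition boundary_map (i : 'I_(npoly S)) :
  graph_map (cycle_graph (nside i)) skeleton.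
Proof.
exists (fun j => \pi_sk_vert (corner_of j))
       (fun d => \pi_sk_dart (corner_of d.1, d.2)) => d /=.
  by rewrite sk_src_pi; case: d => j [].
by rewrite sk_inv_pi.
Defined.

End Skeleton.

(* The word read along the whole [k]-gon from the corner [r], in the direction
   of increasing corners if [dir = true] and in the opposite one otherwise. *)
Definition reading n k (f : graph_map (cycle_graph k) (rose n))
    (r : 'I_k) (dir : bool) : seq (letter n) :=
  let u := rot r [seq (gm_dart f (j, true) : letter n) | j <- enum 'I_k] in
  if dir then u else winv u.

Definition closed_polygonal_surface n (w : freegroup n) (S : side_pairing) :
    Prop :=
  exists phi : graph_map (skeleton S) (rose n),
    immersion phi /\
    forall i : 'I_(npoly S),
      immersion (gm_comp phi (boundary_map i)) /\
      exists r dir (z : int),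
        z <> 0%R /\
        reading (gm_comp phi (boundary_map i)) r dir = fgval (zpow w z).

Definition polygonal n (w : freegroup n) : Prop :=
  cyclically_reduced w /\
  exists S : side_pairing,
    closed_polygonal_surface w S /\ (euler_char S < (npoly S)%:Z)%R.

Definition fa : freegroup 2 := gen ord0.
Definition fb : freegroup 2 := gen ord_max.

(* Main.v *)
Require Import Defs.
From HB Require Import structures.
From mathcomp Require Import all_boot all_order all_algebra zify.
Set Implicit Arguments.
Unset Strict Implicit.
Unset Printing Implicit Defensive.

(** Glue polygons along sides with equal generators, and attach to the ends of
    each side vertex names that the gluing respects and that tell apart the
    edges of one generator leaving (or reaching) a common vertex: then the
    1-skeleton immerses in the rose, and [chi < m] as soon as some vertex has
    three distinct darts.

    The [a]-syllables are strung along circles: where a syllable ends at a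
    corner, the next one begins at a matched corner of opposite [a]-type.
    In (1) corners of opposite types in both generators are matched; in (2)
    the letters [b] are glued in pairs with opposite types at both ends, and (3)
    is an instance of (2).  Gluing two copies of the polygon along the circles
    with a shift by one letter never puts two breaks face to face, because
    syllables have length at least two.

    In (4) let [P <= Q].  Gluing the [b^-1] before a syllable [q_j] to the [b] after it
    makes each [q_j] a circle by itself and all the [p_i] one circle of length
    [P].  Breaks of a [p]-circle and of a [q]-circle may face each other, so
    these can be glued freely (every position of one meets every position of
    the other); the excess of [q]-circles is glued to itself with a shift,
    using only syllables longer than one letter, which is possible when
    [Q' <= P].  This follows from [Q Q' <= P^2]. *)

(** * Products and powers of reduced words without cancellation *)

Lemma wmul_reduced n (u v : seq (letter n)) : reduced (u ++ v) -> wmul u v = u ++ v.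
Proof.
elim: u => //= x u IHu ruv; rewrite IHu; last exact: path_sorted ruv.
by case: (u ++ v) ruv => //= y s /andP[]; rewrite /nocancel => /negbTE ->.
Qed.

Lemma fgval_mul n (f g : freegroup n) :
  reduced (fgval f ++ fgval g) -> fgval (f * g)%g = fgval f ++ fgval g.
Proof. exact: wmul_reduced. Qed.

(** The induction runs from [last x s], because the closing step from there to [x] is exactly the
    junction between two consecutive copies. *)
Lemma cycle_path_nseq (T : Type) (e : rel T) (s : seq T) k :
  cycle e s -> sorted e (flatten (nseq k s)).
Proof.
case: s => [|x s] /=; first by elim: k.
move=> cs; have H : path e (last x s) (flatten (nseq k (x :: s))).
  elim: k => //= k IH; rewrite cat_path IH.
  by move: cs; rewrite rcons_path => /andP[-> ->].
by case: k H => [|k] //= /andP[].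
Qed.

Lemma fgval_expg n (w : freegroup n) k :
  cyclically_reduced w -> fgval (w ^+ k)%g = flatten (nseq k (fgval w)).
Proof.
move=> cw; elim: k => //= k IH; rewrite expgS fgval_mul IH //.
exact: (@cycle_path_nseq _ _ (fgval w) k.+1 cw).
Qed.

Lemma nth_flatten_nseq (T : Type) (x0 : T) (s : seq T) k i :
  i < k * size s -> nth x0 (flatten (nseq k s)) i = nth x0 s (i %% size s).
Proof.
elim: k i => //= k IH i lt_i; rewrite nth_cat; case: ltnP => [lt_is|le_si].
  by rewrite modn_small.
by rewrite IH ?ltn_subLR // -{2}(subnK le_si) modnDr.
Qed.

(** * Orbits of a permutation as boundaries of polygons *)

Section Orbits.
Variables (T : finType) (nxt : T -> T).
Hypothesis nxt_inj : injective nxt.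

Definition orb_root (i : 'I_#|froots nxt|) : T := enum_val i.
Definition orb_size i := order nxt (orb_root i).
Definition orb_side := {i : 'I_#|froots nxt| & 'I_(orb_size i)}.
Definition orb_val (s : orb_side) : T := iter (tagged s) nxt (orb_root (tag s)).

(** Equal values lie in one orbit and so have the same root; [findex] then recovers the number of
    steps, which is below the order. *)
Lemma orb_val_inj : injective orb_val.
Proof.
have cs := fconnect_sym nxt_inj.
move=> [i j] [i' j']; rewrite /orb_val /= => E.
have rt k (t : 'I_(orb_size k)) : froot nxt (iter t nxt (orb_root k)) = orb_root k.
  rewrite -(fingraph.rootP cs (fconnect_iter nxt t _)).
  by have /eqP := enum_valP k.
have ii' : i = i' by apply: enum_val_inj; rewrite -[LHS](rt i j) E rt.
subst i'; congr existT; apply: val_inj => /=.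
by rewrite -(findex_iter (ltn_ord j)) -(findex_iter (ltn_ord j')) E.
Qed.

Lemma orb_val_surj t : exists s, orb_val s == t.
Proof.
have cs := fconnect_sym nxt_inj.
have rt : froot nxt t \in froots nxt by apply: roots_root.
have lt : findex nxt (froot nxt t) t < orb_size (enum_rank_in rt (froot nxt t)).
  by rewrite /orb_size /orb_root enum_rankK_in // findex_max // cs connect_root.
exists (Tagged (fun i => 'I_(orb_size i)) (Ordinal lt)).
rewrite /orb_val /= /orb_root enum_rankK_in // iter_findex //.
by rewrite cs connect_root.
Qed.

Definition orb_side_of (t : T) : orb_side := xchoose (orb_val_surj t).

Lemma orb_side_ofK : cancel orb_side_of orb_val.
Proof. by move=> t; apply/eqP/(xchooseP (orb_val_surj t)). Qed.

Lemma orb_valK : cancel orb_val orb_side_of.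
Proof. by move=> s; apply: orb_val_inj; rewrite orb_side_ofK. Qed.

Lemma orb_val_next i (j : 'I_(orb_size i)) :
  orb_val (Tagged (fun i => 'I_(orb_size i)) (ordS j)) =
  nxt (orb_val (Tagged (fun i => 'I_(orb_size i)) j)).
Proof.
rewrite /orb_val /= -iterS; have := ltn_ord j; rewrite leq_eqVlt => /predU1P[->|lt].
  by rewrite modnn iter_order.
by rewrite modn_small.
Qed.

End Orbits.

(** * The surface obtained from matched sides, and its immersion in the rose *)

Section Gluing.
Local Open Scope quotient_scope.
Variables (n : nat) (w : freegroup n) (T : finType) (X : eqType).
Variables (nxt prv mt : T -> T) (pos : T -> nat) (lab : T -> letter n).
Variables (ori : 'I_n -> bool) (V : 'I_n -> T -> X).

Definition fwd (x : letter n) : bool := x.2 == ori x.1.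
Definition tail_vertex g s : X := if fwd (lab s) then V g s else V g (nxt s).
Definition head_vertex g s : X := if fwd (lab s) then V g (nxt s) else V g s.
(** The letter that leaves the head of the edge of [s] along the polygon without running back
    through [s]. *)
Definition head_turn s : letter n :=
  if fwd (lab s) then lab (nxt s) else linv (lab (prv s)).

(* Reversing [ori] on a generator only exchanges the tails and the heads of its
   edges; the vertex names [V] may depend on the generator they are tested on. *)
Hypothesis w_red : cyclically_reduced w.
Hypothesis nxtK : cancel nxt prv.
Hypothesis pos_lt : forall s, pos s < size (fgval w).
Hypothesis pos_nxt : forall s, pos (nxt s) = (pos s).+1 %% size (fgval w).
Hypothesis labE : forall s x0, lab s = nth x0 (fgval w) (pos s).
Hypothesis mateK : involutive mt.
Hypothesis mate_neq : forall s, mt s != s.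
Hypothesis gen_mate : forall s, (lab (mt s)).1 = (lab s).1.
Hypothesis tail_mate : forall g s, tail_vertex g (mt s) = tail_vertex g s.
Hypothesis head_mate : forall g s, head_vertex g (mt s) = head_vertex g s.
Hypothesis tail_inj : forall s t, (lab s).1 = (lab t).1 ->
  tail_vertex (lab s).1 s = tail_vertex (lab s).1 t -> t = s \/ t = mt s.
Hypothesis head_inj : forall s t, (lab s).1 = (lab t).1 ->
  head_vertex (lab s).1 s = head_vertex (lab s).1 t -> t = s \/ t = mt s.
Hypothesis branch : exists s, head_turn (mt s) != head_turn s.

Let nxt_inj : injective nxt := can_inj nxtK.
Let prvK : cancel prv nxt.
Proof. exact: canF_sym. Qed.

(** Glued sides carry the same generator, so their labels agree along the edge as soon as the gluing
    keeps directions exactly when the exponents agree. *)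
Let same_lab s := (lab (mt s)).2 == (lab s).2.

Let tside := orb_side nxt.
Let val_side : tside -> T := @orb_val T nxt.
Let of_side : T -> tside := orb_side_of nxt_inj.

Lemma gluing_mateK : involutive (of_side \o mt \o val_side).
Proof.
by move=> s; rewrite /= [val_side _]orb_side_ofK mateK [LHS]orb_valK.
Qed.

Lemma gluing_mate_neq s : (of_side \o mt \o val_side) s != s.
Proof.
apply/eqP => /(congr1 val_side); rewrite /= [LHS]orb_side_ofK.
exact/eqP/mate_neq.
Qed.

Lemma gluing_same_mate s :
  (same_lab \o val_side) ((of_side \o mt \o val_side) s) =
  (same_lab \o val_side) s.
Proof. by rewrite /= [val_side (of_side _)]orb_side_ofK /same_lab mateK eq_sym. Qed.

Lemma orb_size_gt0 (i : 'I_#|froots nxt|) : 0 < orb_size i.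
Proof. by rewrite /orb_size order_gt0. Qed.

Definition gluing : side_pairing :=
  @SidePairing #|froots nxt| (@orb_size T nxt) orb_size_gt0
    (of_side \o mt \o val_side) (same_lab \o val_side)
    gluing_mateK gluing_mate_neq gluing_same_mate.

Let value : side gluing -> T := val_side.

Lemma value_inj : injective value.
Proof. exact: orb_val_inj nxt_inj. Qed.

Lemma value_pnext (s : side gluing) : value (pnext s) = nxt (value s).
Proof. by case: s => i j; apply: (@orb_val_next T nxt nxt_inj i j). Qed.

Lemma value_mate (s : side gluing) : value (mate s) = mt (value s).
Proof. exact: (orb_side_ofK nxt_inj). Qed.

Definition dlab (d : pdart gluing) : letter n :=
  if d.2 then lab (value d.1) else linv (lab (value d.1)).

Lemma dlab_pinv d : dlab (pinv d) = linv (dlab d).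
Proof. by case: d => s []; rewrite /dlab /= ?linvK. Qed.

Lemma dlab_glue d : dlab (glue d) = dlab d.
Proof.
case: d => s b; rewrite /dlab /glue /= value_mate /same_lab -/(value s).
have := gen_mate (value s); case: (lab (value s)) => g e.
case: (lab _) => g' e' /= ->.
by case: b e e' => [] [] []; rewrite /linv.
Qed.

Lemma V_psrc g d :
  V g (value (psrc d)) =
  if fwd (dlab d) then tail_vertex g (value d.1) else head_vertex g (value d.1).
Proof.
case: d => s b; rewrite /psrc /dlab /tail_vertex /head_vertex /fwd /linv.
case: b => /=; first by case: ifP => E; rewrite ?E.
by rewrite value_pnext; case: (lab _) => h [] /=; case: (ori h) => /=.
Qed.

Lemma V_corner_adj g c c' : corner_adj c c' -> V g (value c) = V g (value c').
Proof.
case/existsP=> d /andP[/eqP <- /eqP <-]; rewrite !V_psrc dlab_glue.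
by rewrite /glue /= value_mate tail_mate head_mate.
Qed.

(** Names are only required to be constant on vertices. Distinct vertices may share a name; this
    makes the injectivity hypotheses stronger and does no harm. *)
Lemma V_same_vertex g c c' : same_vertex c c' -> V g (value c) = V g (value c').
Proof.
move=> /connectP[p]; elim: p c => [|c1 p IH] c /=; first by move=> _ ->.
by case/andP=> /(V_corner_adj g) -> /IH.
Qed.

Lemma gen_dlab d : (dlab d).1 = (lab (value d.1)).1.
Proof. by case: d => s []. Qed.

(** This is local injectivity. The common name, taken for the generator of the darts, is a tail or a
    head name according to their direction; injectivity leaves the side itself and its mate, and
    equal letters exclude the opposite direction. *)
Lemma dlab_inj d d' : same_vertex (psrc d) (psrc d') -> dlab d = dlab d' -> glued d d'.
Proof.
move=> sv E; have Eg : (lab (value d.1)).1 = (lab (value d'.1)).1.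
  by rewrite -!gen_dlab E.
have : value d'.1 = value d.1 \/ value d'.1 = mt (value d.1).
  have := V_same_vertex (lab (value d.1)).1 sv; rewrite !V_psrc -E.
  by case: ifP => _; [apply: tail_inj | apply: head_inj].
rewrite -value_mate => -[/value_inj | /value_inj] Ed; rewrite /glued.
  apply/orP; left; move: E; rewrite (surjective_pairing d) (surjective_pairing d').
  rewrite -Ed; case: d.2; case: d'.2; rewrite ?eqxx // /dlab /= => /eqP.
    by rewrite eq_sym (negbTE (linv_neq _)).
  by rewrite (negbTE (linv_neq _)).
apply/orP; right; move: E; rewrite -(dlab_glue d).
have -> : d' = ((glue d).1, d'.2) by case: (d') Ed => s b /= ->.
case: (glue d) => s b /=; case: b; case: d'.2; rewrite ?eqxx // /dlab /= => /eqP.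
  by rewrite eq_sym (negbTE (linv_neq _)).
by rewrite (negbTE (linv_neq _)).
Qed.

Definition sk_lab (d : sk_dart gluing) : letter n := dlab (repr d).

Lemma sk_lab_pi d : sk_lab (\pi d) = dlab d.
Proof.
rewrite /sk_lab; have /eqmodP : repr (\pi_(sk_dart gluing) d) = d %[mod sk_dart gluing].
  by rewrite reprK.
by rewrite /= /glued; move: (repr _) => e /orP[] /eqP ->; rewrite ?dlab_glue.
Qed.

Lemma sk_lab_inv (d : sk_dart gluing) : sk_lab (sk_inv d) = linv (sk_lab d).
Proof. by rewrite /sk_inv sk_lab_pi dlab_pinv. Qed.

Definition gluing_map : graph_map (skeleton gluing) (rose n) :=
  @GraphMap (skeleton gluing) (rose n) (fun _ => tt) sk_lab (fun _ => erefl) sk_lab_inv.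

Lemma gluing_immersion : immersion gluing_map.
Proof.
move=> d d' /= /eqmodP /= sv E; rewrite -[d]reprK -[d']reprK.
by apply/eqmodP/dlab_inj.
Qed.

Lemma lab_nocancel s : nocancel (lab s) (lab (nxt s)).
Proof.
have x0 := lab s; rewrite !(labE _ x0) pos_nxt.
have := pos_lt s; move: w_red; rewrite /cyclically_reduced /cycle.
case: (fgval w) => // y u cw; rewrite /= ltnS leq_eqVlt => /predU1P[->|lt].
  (* The last position: its successor is position 0, and cyclic reducedness is what excludes the
     cancellation. *)
  rewrite modnn; move/(pathP x0): cw => /(_ (size u)).
  by rewrite -rcons_cons !nth_rcons size_rcons /= ltnSn ltnn eqxx; apply.
rewrite modn_small //; move/(pathP x0): cw => /(_ (pos s)).
by rewrite -rcons_cons !nth_rcons size_rcons /= ltnS (ltnW lt) lt; apply.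
Qed.


Lemma pos_iter s k : pos (iter k nxt s) = (pos s + k) %% size (fgval w).
Proof.
elim: k => [|k IH]; first by rewrite addn0 modn_small.
by rewrite iterS pos_nxt IH -addn1 modnDml addn1 -addnS.
Qed.

Lemma gm_dart_boundary (i : 'I_(Defs.npoly gluing)) d :
  gm_dart (gm_comp gluing_map (boundary_map i)) d = dlab (corner_of d.1, d.2).
Proof. exact: sk_lab_pi. Qed.

Lemma boundary_immersion (i : 'I_(Defs.npoly gluing)) :
  immersion (gm_comp gluing_map (boundary_map i)).
Proof.
have vS j : value (corner_of (ordS j)) = nxt (value (@corner_of gluing i j)).
  exact: value_pnext (corner_of j).
have nc (j : 'I_(nside i)) :
    lab (value (corner_of (ordS j))) <> linv (lab (value (corner_of j))).
  by rewrite vS; apply/eqP/lab_nocancel.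
move=> [j b] [j' b']; rewrite !gm_dart_boundary /dlab /= /csrc /=.
case: b; case: b' => //=.
- by move=> ->.
- by move=> -> /nc.
- by move=> <- /esym/nc.
- by move=> /ordS_inj ->.
Qed.

Lemma boundary_reading (i : 'I_(Defs.npoly gluing)) : exists r dir (z : int),
  z <> 0%R /\
  reading (gm_comp gluing_map (boundary_map i)) r dir = fgval (zpow w z).
Proof.
set t := orb_root i; set L := size (fgval w).
have L_gt0 : 0 < L by apply: leq_ltn_trans (pos_lt t).
have k_gt0 := nside_gt0 i; set k := nside i in k_gt0 *.
(* After [k] steps the boundary is back at [t], so [k] shifts the position in [w] by a multiple of
   [L]. *)
have dvd_k : L %| k.
  have := pos_iter t k; rewrite [iter _ _ _](iter_order nxt_inj).
  move/eqP; rewrite -{1}(modn_small (pos_lt t)) -{1}[pos t]addn0 eqn_modDl mod0n.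
  by rewrite eq_sym.
(* The reading starts at the first corner whose side has position 0 in [w]. *)
have r_lt : (L - pos t) %% L < k.
  by apply: leq_trans (dvdn_leq k_gt0 dvd_k); rewrite ltn_mod.
have r_pos : (pos t + (L - pos t) %% L) %% L = 0.
  by rewrite modnDmr subnKC ?modnn // ltnW ?pos_lt.
exists (Ordinal r_lt), true, (Posz (k %/ L)); split.
  by case=> k0; move: k_gt0; rewrite -(divnK dvd_k) k0.
rewrite /reading [RHS]fgval_expg //; move: {r_lt}(_ %% L) (r_lt) r_pos => r r_lt r_pos.
set u := map _ _; have u_size : size u = k by rewrite size_map size_enum_ord.
have x0 := lab t.
have u_nth j : j < k -> nth x0 u j = nth x0 (fgval w) ((pos t + j) %% L).
  move=> lt_j; rewrite (nth_map (Ordinal lt_j)) ?size_enum_ord //.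
  by rewrite gm_dart_boundary /dlab /= (labE _ x0) pos_iter nth_enum_ord.
have sz : size (flatten (nseq (k %/ L) (fgval w))) = k.
  rewrite -[RHS](divnK dvd_k) size_flatten /shape map_nseq.
  by elim: (k %/ L) => //= m ->; rewrite mulSn.
apply: (@eq_from_nth _ x0) => [|j]; rewrite size_rot u_size // => lt_j.
rewrite nth_flatten_nseq ?divnK // nth_cat size_drop u_size /=.
case: ltnP => lt_jr.
  rewrite nth_drop u_nth; last by rewrite -ltn_subRL.
  by rewrite addnA -modnDml r_pos.
rewrite nth_take ?u_nth; try lia.
congr nth; apply/eqP; rewrite -(eqn_modDr k).
have -> : pos t + (j - (k - r)) + k = pos t + r + j by lia.
by rewrite -modnDml r_pos add0n -modnDmr (eqP dvd_k) addn0.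
Qed.

(** * Degrees of the vertices and the Euler characteristic *)

Let vtx (t : T) : sk_vert gluing := \pi_(sk_vert gluing) (of_side t : side gluing).

Lemma vtx_value s : vtx (value s) = \pi_(sk_vert gluing) s.
Proof. by rewrite /vtx [of_side _]orb_valK. Qed.

Lemma vtx_out t : exists2 d : sk_dart gluing, sk_src d = vtx t & sk_lab d = lab t.
Proof.
exists (\pi_(sk_dart gluing) ((of_side t, true) : pdart gluing)); first by rewrite sk_src_pi.
by rewrite sk_lab_pi /dlab /= [value _]orb_side_ofK.
Qed.

Lemma vtx_in t :
  exists2 d : sk_dart gluing, sk_src d = vtx t & sk_lab d = linv (lab (prv t)).
Proof.
exists (\pi_(sk_dart gluing) ((of_side (prv t), false) : pdart gluing)); last first.
  by rewrite sk_lab_pi /dlab /= [value _]orb_side_ofK.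
by rewrite sk_src_pi /psrc /= -vtx_value value_pnext [value _]orb_side_ofK prvK.
Qed.

Lemma degree_ge (v : sk_vert gluing) (ls : seq (letter n)) : uniq ls ->
    (forall x, x \in ls -> exists2 d : sk_dart gluing, sk_src d = v & sk_lab d = x) ->
  size ls <= #|[pred d : sk_dart gluing | sk_src d == v]|.
Proof.
move=> uls h; rewrite cardE -(size_map sk_lab); apply: uniq_leq_size => // x /h.
by case=> d dv <-; apply: map_f; rewrite mem_enum inE dv.
Qed.

(** Any corner at [v] supplies the letter leaving it and the inverse of the letter arriving at it;
    they differ because [w] is cyclically reduced. *)
Lemma degree_ge2 (v : sk_vert gluing) :
  2 <= #|[pred d : sk_dart gluing | sk_src d == v]|.
Proof.
have vE : vtx (value (repr v)) = v by rewrite vtx_value reprK.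
set t := value (repr v) in vE.
apply: (@degree_ge _ [:: lab t; linv (lab (prv t))]).
  by rewrite /= inE andbT; have := lab_nocancel (prv t); rewrite prvK.
move=> x; rewrite !inE -vE => /orP[] /eqP ->; first exact: vtx_out.
exact: vtx_in.
Qed.

Let head_vtx t := vtx (if fwd (lab t) then nxt t else t).

Lemma head_vtx_mate t : head_vtx (mt t) = head_vtx t.
Proof.
rewrite /head_vtx; apply/eqmodP/connect1/existsP.
set d : pdart gluing := (of_side (mt t), ~~ fwd (lab (mt t))); exists d.
have Ev s : value (of_side s) = s by apply: orb_side_ofK.
have Ep s b : psrc ((of_side s, b) : pdart gluing) = of_side (if b then s else nxt s).
  by case: b => //; apply: value_inj; rewrite value_pnext !Ev.
have -> : glue d = (of_side t, ~~ fwd (lab t)).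
  rewrite /d /glue /=; congr pair; first by rewrite -[val_side _]/(value _) Ev mateK.
  rewrite -[val_side _]/(value _) Ev /same_lab mateK /fwd gen_mate.
  by case: (lab t) (lab (mt t)) => g [] [g' []] /=; case: (ori g).
by rewrite /d !Ep; case: (fwd _); case: (fwd _); rewrite !eqxx.
Qed.

Lemma head_vtx_turn t :
  exists2 d : sk_dart gluing, sk_src d = head_vtx t & sk_lab d = head_turn t.
Proof.
by rewrite /head_vtx /head_turn; case: ifP => _; [apply: vtx_out | apply: vtx_in].
Qed.

Lemma head_vtx_dart t : exists2 d : sk_dart gluing,
  sk_src d = head_vtx t & sk_lab d = ((lab t).1, ~~ ori (lab t).1).
Proof.
rewrite /head_vtx /fwd; case: ifP => E.
  have [d ds dl] := vtx_in (nxt t); exists d => //.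
  by rewrite dl nxtK /linv (eqP E).
have [d ds dl] := vtx_out t; exists d => //; rewrite dl.
by case: (lab t) E => g e /=; case: e (ori g) => [] [].
Qed.

Lemma head_turn_neq t : head_turn t != ((lab t).1, ~~ ori (lab t).1).
Proof.
rewrite /head_turn /fwd; case: ifP => E.
  have := lab_nocancel t; rewrite /nocancel; apply: contraNneq => ->.
  by rewrite /linv (eqP E).
have := lab_nocancel (prv t); rewrite prvK /nocancel; apply: contraNneq => ->.
by case: (lab t) E => g e /=; case: e (ori g) => [] [].
Qed.

(** [nedges] halves the number of darts with rounding, so parity is needed. Inversion exchanges the
    darts with positive and negative labels. *)
Lemma card_sk_dart_even : ~~ odd #|{: sk_dart gluing}|.
Proof.
set A := [pred d : sk_dart gluing | (sk_lab d).2].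
rewrite -(cardC A); suff -> : #|[predC A]| = #|A| by rewrite addnn odd_double.
rewrite -(card_image (inv_inj (@sk_invK gluing)) A); apply: eq_card => d.
apply/idP/imageP => [dA | [e eA ->]].
  exists (sk_inv d); last by rewrite sk_invK.
  by rewrite inE sk_lab_inv.
by rewrite !inE sk_lab_inv /= negbK.
Qed.

(** The number of darts is the sum of the degrees. All are at least 2, and the vertex given by
    [branch] has three darts: the two turns and the edge itself. *)
Lemma card_sk_vert_lt : #|{: sk_vert gluing}|.*2 < #|{: sk_dart gluing}|.
Proof.
have -> : #|{: sk_dart gluing}| =
    \sum_(v : sk_vert gluing) #|[pred d : sk_dart gluing | sk_src d == v]|.
  rewrite -sum1_card (partition_big (@sk_src gluing) xpredT) //=.
  by apply: eq_bigr => v _; rewrite -sum1_card.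
have [t turn] := branch.
rewrite -muln2 -sum_nat_const (bigD1 (head_vtx t)) // [ltnRHS](bigD1 (head_vtx t)) //=.
rewrite -addSn; apply: leq_add; last by apply: leq_sum => v _; apply: degree_ge2.
apply: (@degree_ge _ [:: head_turn t; head_turn (mt t); ((lab t).1, ~~ ori (lab t).1)]).
  rewrite /= !inE !negb_or head_turn_neq eq_sym turn.
  by have := head_turn_neq (mt t); rewrite gen_mate => ->.
move=> x; rewrite !inE => /or3P[] /eqP ->.
- exact: head_vtx_turn.
- by rewrite -head_vtx_mate; apply: head_vtx_turn.
- exact: head_vtx_dart.
Qed.

Lemma polygonal_gluing_total : polygonal w.
Proof.
split=> //; exists gluing; split.
  exists gluing_map; split; first exact: gluing_immersion.
  by move=> i; split; [apply: boundary_immersion | apply: boundary_reading].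
have := card_sk_vert_lt; rewrite -(even_halfK card_sk_dart_even) ltn_double.
by rewrite /euler_char /nedges /=; lia.
Qed.

End Gluing.

(** The same criterion on a subset [D] stable under [nxt] and [mt], so that sides can be cut out of
    a product type without dependent pairs in the applications. *)
Lemma polygonal_gluing n (w : freegroup n) (T : finType) (X : eqType) (D : {pred T})
    (nxt prv mt : T -> T) (pos : T -> nat) (lab : T -> letter n)
    (ori : 'I_n -> bool) (V : 'I_n -> T -> X) :
    cyclically_reduced w ->
    {homo nxt : s / s \in D} -> {homo mt : s / s \in D} ->
    {in D, cancel nxt prv} ->
    {in D, forall s, pos s < size (fgval w)} ->
    {in D, forall s, pos (nxt s) = (pos s).+1 %% size (fgval w)} ->
    (forall s x0, lab s = nth x0 (fgval w) (pos s)) ->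
    {in D, cancel mt mt} -> {in D, forall s, mt s != s} ->
    {in D, forall s, (lab (mt s)).1 = (lab s).1} ->
    (forall g, {in D, forall s, tail_vertex nxt lab ori V g (mt s) = tail_vertex nxt lab ori V g s}) ->
    (forall g, {in D, forall s, head_vertex nxt lab ori V g (mt s) = head_vertex nxt lab ori V g s}) ->
    {in D &, forall s t, (lab s).1 = (lab t).1 ->
      tail_vertex nxt lab ori V (lab s).1 s = tail_vertex nxt lab ori V (lab s).1 t ->
      t = s \/ t = mt s} ->
    {in D &, forall s t, (lab s).1 = (lab t).1 ->
      head_vertex nxt lab ori V (lab s).1 s = head_vertex nxt lab ori V (lab s).1 t ->
      t = s \/ t = mt s} ->
    (exists2 s, s \in D & head_turn nxt prv lab ori (mt s) != head_turn nxt prv lab ori s) ->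
  polygonal w.
Proof.
move=> w_red nxtD mtD nxtK pos_lt pos_nxt labE mtK mt_neq gen_mt tail_mt head_mt tinj hinj [b bD bE].
pose T' := {s | s \in D}.
pose nxt' (s : T') : T' := exist _ (nxt (val s)) (nxtD _ (valP s)).
pose mt' (s : T') : T' := exist _ (mt (val s)) (mtD _ (valP s)).
pose prv' (s : T') : T' := insubd s (prv (val s)).
have nxtK' : cancel nxt' prv'.
  by move=> s; apply: val_inj; rewrite val_insubd /= nxtK ?(valP s) //.
(* An injection of a finite type is onto, so every side of [D] is a successor in [D]; hence [prv]
   also stays in [D]. *)
have prvE s : val (prv' s) = prv (val s).
  by rewrite -{2}[s](canF_sym nxtK') /= nxtK ?(valP (prv' s)).
have or_val (s t : T') : val t = val s \/ val t = mt (val s) -> t = s \/ t = mt' s.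
  by case=> E; [left | right]; apply: val_inj.
apply: (@polygonal_gluing_total n w _ X nxt' prv' mt' (pos \o val) (lab \o val) ori
  (fun g s => V g (val s))) => //.
- by move=> s; apply: pos_lt (valP s).
- by move=> s; apply: pos_nxt (valP s).
- by move=> s x0; apply: labE.
- by move=> s; apply: val_inj; apply: mtK (valP s).
- by move=> s; apply: mt_neq (valP s).
- by move=> s; apply: gen_mt (valP s).
- by move=> g s; apply: tail_mt (valP s).
- by move=> g s; apply: head_mt (valP s).
- by move=> s t Eg Et; apply: or_val; apply: tinj (valP s) (valP t) Eg Et.
- by move=> s t Eg Et; apply: or_val; apply: hinj (valP s) (valP t) Eg Et.
exists (exist _ b bD); apply: contraNneq bE; rewrite /head_turn /=.
by rewrite !prvE /= => ->.
Qed.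

(** * Words as cyclic sequences of syllables *)

Lemma cycle_nth (T : Type) (e : rel T) (x0 : T) (s : seq T) :
  (forall i, i < size s -> e (nth x0 s i) (nth x0 s (i.+1 %% size s))) -> cycle e s.
Proof.
case: s => // y u h; apply/(pathP x0) => i; rewrite size_rcons ltnS => le_i.
have := h i le_i; rewrite -rcons_cons !nth_rcons /= ltnS le_i.
case: (ltngtP i (size u)) le_i => // [lt_i | ->] _; first by rewrite modn_small.
by rewrite modnn.
Qed.

Lemma insubd_ord n (u : 'I_n) t : insubd u t = (if t < n then t else u) :> nat.
Proof. exact: val_insubd. Qed.

Lemma size_flatten_take (T : Type) (B : seq (seq T)) i j :
  i <= j -> size (flatten (take i B)) <= size (flatten (take j B)).
Proof. by move=> /subnKC <-; rewrite takeD flatten_cat size_cat leq_addr. Qed.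

Section Syllables.
Variables (n m : nat) (c : 'I_m -> letter n) (len : 'I_m -> nat).
Hypothesis len_gt0 : forall k, 0 < len k.
Hypothesis alt : forall k, (c (ordS k)).1 != (c k).1.

Definition sylword : seq (letter n) := flatten [seq nseq (len k) (c k) | k <- enum 'I_m].

Definition slot : finType := {k : 'I_m & 'I_(len k)}.

(** Total in [t]: an offset beyond the syllable is read as 0, which keeps bound proofs out of the
    terms. *)
Definition at_ k (t : nat) : slot := Tagged (fun k => 'I_(len k)) (insubd (Ordinal (len_gt0 k)) t).
Definition syl (o : slot) : 'I_m := tag o.
Definition soff (o : slot) : nat := tagged o.
Definition slab (o : slot) : letter n := c (syl o).
Definition fst_ k := at_ k 0.
Definition lst k := at_ k (len k).-1.
Definition nx (o : slot) : slot :=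
  if (soff o).+1 < len (tag o) then at_ (tag o) (soff o).+1 else fst_ (ordS (tag o)).
Definition pv (o : slot) : slot :=
  if 0 < soff o then at_ (tag o) (soff o).-1 else lst (ord_pred (tag o)).
Definition slot_pos (o : slot) : nat :=
  size (flatten (take (tag o) [seq nseq (len k) (c k) | k <- enum 'I_m])) + soff o.

Lemma val_at k t : t < len k -> soff (at_ k t) = t.
Proof. by move=> lt_t; rewrite /soff /at_ /= insubd_ord lt_t. Qed.

Lemma atE o : o = at_ (tag o) (soff o).
Proof. by case: o => k t; congr existT; apply: val_inj; rewrite /= insubd_ord ltn_ord. Qed.

Lemma slotP o : exists k t, t < len k /\ o = at_ k t.
Proof. by exists (tag o), (soff o); split; [exact: ltn_ord (tagged o) | apply: atE]. Qed.

Lemma at_inj k t t' : t < len k -> t' < len k -> at_ k t = at_ k t' -> t = t'.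
Proof. by move=> lt lt' /(congr1 soff); rewrite !val_at. Qed.

Lemma syl_fst k : syl (fst_ k) = k. Proof. by []. Qed.
Lemma syl_lst k : syl (lst k) = k. Proof. by []. Qed.

Lemma lst_at k t : t < len k -> (at_ k t == lst k) = (t.+1 == len k).
Proof.
move=> lt_t; apply/eqP/eqP => [/at_inj -> //|E]; rewrite ?ltn_predL ?prednK //.
by rewrite /lst -E.
Qed.

Lemma nx_lst k : nx (lst k) = fst_ (ordS k).
Proof. by rewrite /nx /soff /= insubd_ord ltn_predL len_gt0 prednK // ltnn. Qed.

Lemma nx_at k t : t.+1 < len k -> nx (at_ k t) = at_ k t.+1.
Proof. by move=> lt_t; rewrite /nx /soff /= insubd_ord (ltnW lt_t) lt_t. Qed.

Lemma pv_fst k : pv (fst_ k) = lst (ord_pred k).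
Proof. by rewrite /pv /soff /= insubd_ord len_gt0. Qed.

Lemma pv_at k t : t.+1 < len k -> pv (at_ k t.+1) = at_ k t.
Proof. by move=> lt_t; rewrite /pv /soff /= insubd_ord lt_t. Qed.

Lemma nxK : cancel nx pv.
Proof.
move=> o; case: (slotP o) => k [t [lt_t ->]].
case: (ltnP t.+1 (len k)) => [lt | le]; first by rewrite nx_at ?pv_at.
have /eqP-> : at_ k t == lst k by rewrite lst_at // eqn_leq lt_t.
by rewrite nx_lst pv_fst ordSK.
Qed.

Lemma pvK : cancel pv nx.
Proof. exact: canF_sym nxK. Qed.

Lemma syl_nx o : o != lst (syl o) -> syl (nx o) = syl o.
Proof.
case: (slotP o) => k [t [lt_t ->]]; rewrite [syl _]/= lst_at // => ne_t.
by rewrite nx_at // ltn_neqAle ne_t.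
Qed.

Lemma fst_lst k : (fst_ k == lst k) = (len k == 1).
Proof. by rewrite lst_at. Qed.

Lemma slab_nx_gen o : ((slab (nx o)).1 == (slab o).1) = (o != lst (syl o)).
Proof.
have [E|ne] := eqVneq o (lst (syl o)); last by rewrite /slab (syl_nx ne) eqxx.
by rewrite E nx_lst /slab syl_fst syl_lst (negbTE (alt _)).
Qed.

Lemma slab_nx o : o != lst (syl o) -> slab (nx o) = slab o.
Proof. by move=> /syl_nx E; rewrite /slab E. Qed.

Lemma slab_nocancel o : slab (nx o) != linv (slab o).
Proof.
have [El|/slab_nx ->] := eqVneq o (lst (syl o)); last by rewrite eq_sym linv_neq.
apply/eqP => /(congr1 (fun x => x.1)) /eqP; rewrite slab_nx_gen.
by rewrite -El eqxx.
Qed.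

Lemma size_take_blocks k : size (flatten (take k.+1 [seq nseq (len k) (c k) | k <- enum 'I_m]))
  = size (flatten (take k [seq nseq (len k) (c k) | k <- enum 'I_m]))
    + oapp len 0 (insub k).
Proof.
case: insubP => [i lt_k /= <- | ]; last first.
  rewrite -leqNgt => le_k; rewrite !take_oversize ?addn0 // size_map size_enum_ord //.
  exact: leqW.
rewrite (take_nth [::]); last by rewrite size_map size_enum_ord.
rewrite -cats1 flatten_cat size_cat /= cats0. 
by rewrite (nth_map i) ?size_enum_ord // nth_ord_enum size_nseq.
Qed.

Lemma size_sylword : size sylword =
  size (flatten (take m [seq nseq (len k) (c k) | k <- enum 'I_m])).
Proof. by rewrite take_oversize // size_map size_enum_ord. Qed.

Lemma slot_pos_at k t : t < len k ->
  slot_pos (at_ k t) = slot_pos (fst_ k) + t.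
Proof. by move=> lt_t; rewrite /slot_pos /soff /= !insubd_ord lt_t len_gt0 addn0. Qed.

Lemma slot_pos_end (k : 'I_m) :
  size (flatten (take k.+1 [seq nseq (len k) (c k) | k <- enum 'I_m]))
  = slot_pos (fst_ k) + len k.
Proof.
rewrite size_take_blocks insubT ?ltn_ord //= => lt_k.
rewrite /slot_pos /soff /= insubd_ord len_gt0 addn0; congr (_ + len _); exact: val_inj.
Qed.

Lemma slot_pos_lt o : slot_pos o < size sylword.
Proof.
case: (slotP o) => k [t [lt_t ->]]; rewrite slot_pos_at //.
apply: (@leq_trans (slot_pos (fst_ k) + len k)); first by rewrite ltn_add2l.
rewrite -slot_pos_end size_sylword.
exact/size_flatten_take/ltn_ord.
Qed.

Lemma slot_pos_nx o : slot_pos (nx o) = (slot_pos o).+1 %% size sylword.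
Proof.
have := slot_pos_lt (nx o); case: (slotP o) => k [t [lt_t ->]].
case: (ltnP t.+1 (len k)) => [lt | le].
  by rewrite nx_at // (slot_pos_at lt) (slot_pos_at lt_t) addnS => /modn_small ->.
have E : t.+1 = len k by apply/eqP; rewrite eqn_leq lt_t.
have /eqP-> : at_ k t == lst k by rewrite lst_at // E.
rewrite nx_lst /lst slot_pos_at ?ltn_predL // -addnS prednK // -slot_pos_end.
rewrite {1 2}/slot_pos /soff /= insubd_ord len_gt0 addn0.
have := ltn_ord k; rewrite leq_eqVlt => /predU1P[Ek | lt_k].
  have -> : size (flatten (take k.+1 [seq nseq (len k) (c k) | k <- enum 'I_m])) =
    size sylword by rewrite size_sylword !take_oversize // size_map size_enum_ord ?Ek.
  have -> : k.+1 %% m = 0 by rewrite Ek modnn.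
  by rewrite take0 modnn.
by rewrite (modn_small lt_k) => /modn_small.
Qed.

Lemma slabE o x0 : slab o = nth x0 sylword (slot_pos o).
Proof.
case: (slotP o) => k [t [lt_t ->]]; rewrite slot_pos_at // /slot_pos /soff /= insubd_ord len_gt0 addn0.
rewrite /sylword -{1}(cat_take_drop k [seq _ | k <- _]) flatten_cat nth_cat.
rewrite ltnNge leq_addr addKn (drop_nth [::]); last by rewrite size_map size_enum_ord.
rewrite [flatten _]/=.
rewrite (nth_map k) ?size_enum_ord // nth_ord_enum nth_cat size_nseq lt_t nth_nseq lt_t.
by [].
Qed.

Lemma slot_pos_iter o i : slot_pos (iter i nx o) = (slot_pos o + i) %% size sylword.
Proof.
elim: i => [|i IH]; first by rewrite addn0 modn_small ?slot_pos_lt.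
by rewrite iterS slot_pos_nx IH -addn1 modnDml addn1 -addnS.
Qed.

Lemma sylword_cycle : cycle (@nocancel n) sylword.
Proof.
case E : (size sylword) => [|L]; first by move/eqP: E; rewrite size_eq0 => /eqP ->.
have m_gt0 : 0 < m.
  rewrite lt0n; apply: contra_eq_neq E => m0; rewrite size_sylword.
  by move: [seq _ | k <- _] => B; rewrite m0 take0.
have x0 := c (Ordinal m_gt0).
apply: (@cycle_nth _ _ x0) => i lt_i.
(* A slot at position [i]: walk from the first slot to the end of the word, then [i] steps
   further. *)
pose o := iter (size sylword - slot_pos (fst_ (Ordinal m_gt0)) + i) nx (fst_ (Ordinal m_gt0)).
have o_pos : slot_pos o = i.
  rewrite slot_pos_iter addnA subnKC; last exact/ltnW/slot_pos_lt.
  by rewrite modnDl modn_small.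
rewrite -{1}o_pos -o_pos -slot_pos_nx -!slabE.
exact: slab_nocancel.
Qed.

End Syllables.

(** * Circles of syllables and two shifted copies *)

(** An element is sent to the one of the same rank in the enumeration of the partner fibre, so going
    back undoes it. *)
Lemma fiber_matching (U : finType) (A : {pred U}) (K : eqType) (key : U -> K) (kap : K -> K) :
    involutive kap ->
    (forall k, #|[pred u in A | key u == k]| = #|[pred u in A | key u == kap k]|) ->
  exists f : U -> U, [/\ {homo f : u / u \in A}, {in A, cancel f f} &
    {in A, forall u, key (f u) = kap (key u)}].
Proof.
move=> kapK cardE; pose F k := enum [pred u in A | key u == k].
have sF k : size (F (kap k)) = size (F k) by rewrite /F -!(fintype.cardE [pred u in A | _]) -cardE.
pose f u := nth u (F (kap (key u))) (index u (F (key u))).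
have memF u : u \in A -> u \in F (key u) by move=> uA; rewrite mem_enum inE uA eqxx.
have fF u : u \in A -> f u \in F (kap (key u)).
  by move=> uA; rewrite mem_nth // sF index_mem memF.
have fP u : u \in A -> f u \in A /\ key (f u) = kap (key u).
  by move=> /fF; rewrite mem_enum inE => /andP[-> /eqP].
exists f; split=> [u /fP[] // | u uA | u /fP[] //].
have [fA fk] := fP u uA; rewrite {1}/f fk kapK {2}/f index_uniq ?enum_uniq //.
  by rewrite (set_nth_default u) ?nth_index ?index_mem ?memF.
by rewrite sF index_mem memF.
Qed.

Lemma gen2P (g h k : 'I_2) : h != g -> k != g -> h = k.
Proof. by move=> hg kg; apply/val_inj; move: (ltn_ord g) (ltn_ord h) (ltn_ord k) hg kg; rewrite -!val_eqE /=; lia. Qed.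

(** * Ends of edges at the corners, and circles of edges of one generator *)

Section Corners.
Variables (O : finType) (nx pv : O -> O) (lab : O -> letter 2).
Hypotheses (nxK : cancel nx pv) (pvK : cancel pv nx).
Hypothesis nocan : forall o, lab (nx o) != linv (lab o).

(* A corner is named by the side that ends there. *)
Definition brk k := (lab (nx k)).1 != (lab k).1.
(** [hc] and [tc] are the corners at the head and the tail of a side, in the direction of its
    generator and not in that of the reading. *)
Definition hc o := if (lab o).2 then o else pv o.
Definition tc o := if (lab o).2 then pv o else o.
Definition has_head g k := (lab k == (g, true)) || (lab (nx k) == (g, false)).
Definition has_tail g k := (lab k == (g, false)) || (lab (nx k) == (g, true)).
Definition hside g k := if lab k == (g, true) then k else nx k.
Definition tside g k := if lab k == (g, false) then k else nx k.

Lemma hsideP g k : has_head g k -> (lab (hside g k)).1 = g /\ hc (hside g k) = k.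
Proof.
rewrite /has_head /hside /hc; case: eqP => /= [->|_ /eqP E]; first by [].
by rewrite E nxK.
Qed.

Lemma tsideP g k : has_tail g k -> (lab (tside g k)).1 = g /\ tc (tside g k) = k.
Proof.
rewrite /has_tail /tside /tc; case: eqP => /= [->|_ /eqP E]; first by [].
by rewrite E nxK.
Qed.

Lemma hc_hside o : has_head (lab o).1 (hc o) /\ hside (lab o).1 (hc o) = o.
Proof.
rewrite /has_head /hside /hc; have := nocan (pv o); rewrite pvK.
case E: (lab o) => [g e] /=; case: e E => E /=; first by rewrite E eqxx.
rewrite pvK E eqxx orbT => nc; split=> //; case: eqP => // E'.
by rewrite E' eqxx in nc.
Qed.

Lemma tc_tside o : has_tail (lab o).1 (tc o) /\ tside (lab o).1 (tc o) = o.
Proof.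
rewrite /has_tail /tside /tc; have := nocan (pv o); rewrite pvK.
case E: (lab o) => [g e] /=; case: e E => E /=; last by rewrite E eqxx.
rewrite pvK E eqxx orbT => nc; split=> //; case: eqP => // E'.
by rewrite E' eqxx in nc.
Qed.

(** With two generators exactly one of the sides meeting at a break carries [g]. Whether it has its
    head there is the [g]-type of the break. *)
Lemma has_tail_brk g k : brk k -> has_tail g k = ~~ has_head g k.
Proof.
rewrite /brk /has_tail /has_head.
case: (lab k) => h e; case: (lab (nx k)) => h' e' /=; rewrite !xpair_eqE => ne.
case: (eqVneq h g) ne => [->|hg] ne; first by rewrite (negbTE ne); case: e.
have [_|h'g] := eqVneq h' g; first by case: e'.
by rewrite (gen2P hg h'g) eqxx in ne.
Qed.

(** Inside a syllable both sides carry the same letter, one with its head and one with its tail at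
    the corner. *)
Lemma has_tail_nbrk g k : ~~ brk k -> has_tail g k = has_head g k.
Proof.
rewrite /brk negbK /has_tail /has_head => /eqP E; have := nocan k.
case: (lab k) E => h e; case: (lab (nx k)) => h' e' /= ->; rewrite /linv !xpair_eqE /= eqxx /=.
by case: (h == g); case: e; case: e'.
Qed.

Lemma card_has_head g : #|[pred k | has_head g k]| = #|[pred o | (lab o).1 == g]|.
Proof.
rewrite -(@card_in_image _ _ hc [pred o | (lab o).1 == g]); last first.
  move=> o o'; rewrite !inE => /eqP E /eqP E' Eh.
  by rewrite -(hc_hside o).2 -(hc_hside o').2 E E' Eh.
apply: eq_card => k; rewrite !inE; apply/idP/imageP => [/hsideP[E <-] | [o]].
  by exists (hside g k); rewrite // inE E.
by rewrite inE => /eqP <- ->; case: (hc_hside o).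
Qed.

Lemma card_has_tail g : #|[pred k | has_tail g k]| = #|[pred o | (lab o).1 == g]|.
Proof.
rewrite -(@card_in_image _ _ tc [pred o | (lab o).1 == g]); last first.
  move=> o o'; rewrite !inE => /eqP E /eqP E' Eh.
  by rewrite -(tc_tside o).2 -(tc_tside o').2 E E' Eh.
apply: eq_card => k; rewrite !inE; apply/idP/imageP => [/tsideP[E <-] | [o]].
  by exists (tside g k); rewrite // inE E.
by rewrite inE => /eqP <- ->; case: (tc_tside o).
Qed.

(** Heads and tails of [g]-edges are equally many, and so are those at corners inside syllables; the
    breaks of the two types remain. *)
Lemma card_brk_head g :
  #|[pred k | brk k && has_head g k]| = #|[pred k | brk k && ~~ has_head g k]|.
Proof.
have := card_has_head g; rewrite -card_has_tail -(cardID brk) -[RHS](cardID brk).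
have -> : #|[predD [pred k | has_head g k] & brk]| = #|[predD [pred k | has_tail g k] & brk]|.
  by apply: eq_card => k; rewrite !inE -!topredE /=; case E: (brk k) => //=; rewrite has_tail_nbrk ?E.
move/addIn; congr (_ = _); apply: eq_card => k; rewrite !inE -!topredE /= andbC.
  by [].
by case E: (brk k) => //=; rewrite has_tail_brk.
Qed.

Definition touch g k := has_head g k || has_tail g k.

Lemma touchE g k : touch g k = ((lab k).1 == g) || ((lab (nx k)).1 == g).
Proof.
rewrite /touch /has_head /has_tail; case: (lab k) => h e; case: (lab (nx k)) => h' e'.
by rewrite !xpair_eqE /=; case: (h == g); case: (h' == g); case: e; case: e'.
Qed.

Section Matching.
Variable N : O -> O.
Hypotheses (NK : involutive N) (N_nbrk : forall k, ~~ brk k -> N k = k).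
Hypothesis N_brk : forall k, brk (N k) = brk k.

Section Generator.
Variable g : 'I_2.
Hypothesis N_flip : forall k, brk k -> has_head g (N k) = ~~ has_head g k.
Hypothesis long : forall o, (lab o).1 = g -> ~~ (brk (hc o) && brk (tc o)).

(** The next edge on the circle of [o]: cross from the head of [o] to the matched corner and take
    the edge starting there. [lam] is the previous edge. *)
Definition rho o := tside g (N (hc o)).
Definition lam o := hside g (N (tc o)).
(** The edge that arrives at the vertex formed by [k] and [N k]: if [k] has a tail, the head is at
    [N k], which is [k] itself inside a syllable. *)
Definition vhead k := if has_tail g k then hside g (N k) else hside g k.

Lemma has_head_N k : has_head g (N k) = has_tail g k.
Proof.
have [b|nb] := boolP (brk k); first by rewrite N_flip // has_tail_brk.
by rewrite N_nbrk // has_tail_nbrk.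
Qed.

Lemma has_tail_N k : has_tail g (N k) = has_head g k.
Proof. by rewrite -has_head_N NK. Qed.

Lemma rhoP o : (lab o).1 = g -> [/\ (lab (rho o)).1 = g, tc (rho o) = N (hc o) & lam (rho o) = o].
Proof.
move=> og; have [ho ho'] := hc_hside o; rewrite og in ho ho'.
have [E1 E2] : (lab (rho o)).1 = g /\ tc (rho o) = N (hc o).
  by apply: tsideP; rewrite has_tail_N.
by split=> //; rewrite /lam E2 NK ho'.
Qed.

Lemma lamP o : (lab o).1 = g -> [/\ (lab (lam o)).1 = g, hc (lam o) = N (tc o) & rho (lam o) = o].
Proof.
move=> og; have [ho ho'] := tc_tside o; rewrite og in ho ho'.
have [E1 E2] : (lab (lam o)).1 = g /\ hc (lam o) = N (tc o).
  by apply: hsideP; rewrite has_head_N.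
by split=> //; rewrite /rho E2 NK ho'.
Qed.

Lemma lam_inj o o' : (lab o).1 = g -> (lab o').1 = g -> lam o = lam o' -> o = o'.
Proof. by move=> /lamP[_ _ {2}<-] /lamP[_ _ {2}<-] ->. Qed.

Lemma vheadP k : touch g k -> (lab (vhead k)).1 = g /\ (hc (vhead k) = k \/ hc (vhead k) = N k).
Proof.
rewrite /touch /vhead; case: ifP => [ht _ | _].
  by have [-> ->] := @hsideP g (N k) (etrans (has_head_N k) ht); auto.
by rewrite orbF => /hsideP[-> ->]; auto.
Qed.

Lemma vhead_hc o : (lab o).1 = g -> vhead (hc o) = o.
Proof.
move=> og; have [ho ho'] := hc_hside o; rewrite og in ho ho'; rewrite /vhead.
case: ifP => // ht; rewrite N_nbrk //; apply/negP => b.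
by rewrite has_tail_brk // ho in ht.
Qed.

Lemma vhead_tc o : (lab o).1 = g -> vhead (tc o) = lam o.
Proof. by move=> og; have [] := tc_tside o; rewrite og /vhead => ->. Qed.

Lemma vhead_N k : brk k -> vhead (N k) = vhead k.
Proof. by move=> b; rewrite /vhead has_tail_N has_tail_brk // NK; case: has_head. Qed.

Lemma touch_brk k : brk k -> touch g k.
Proof. by move=> b; rewrite /touch has_tail_brk // orbN. Qed.

Lemma touch_hc o : (lab o).1 = g -> touch g (hc o).
Proof. by move=> og; have [] := hc_hside o; rewrite og /touch => ->. Qed.

Lemma touch_tc o : (lab o).1 = g -> touch g (tc o).
Proof. by move=> og; have [] := tc_tside o; rewrite og /touch orbC => ->. Qed.

(* The sides of the first copy of the polygon are glued along the circles of
   [rho] to those of the second one, shifted by one; [vert] names a vertex by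
   the side of the first copy whose head is there. *)
Definition vert (b : bool) k := if b then lam (vhead k) else vhead k.

Definition gmate (s : bool * O) : bool * O := if s.1 then (false, lam s.2) else (true, rho s.2).

Lemma gmateP (s : bool * O) : (lab s.2).1 = g ->
  [/\ gmate (gmate s) = s, (lab (gmate s).2).1 = g,
      vert (gmate s).1 (tc (gmate s).2) = vert s.1 (tc s.2) &
      vert (gmate s).1 (hc (gmate s).2) = vert s.1 (hc s.2)].
Proof.
case: s => [[] o] /= og; rewrite /gmate /vert /=.
  have [E1 E2 E3] := lamP og.
  by split=> //; rewrite ?E3 // ?vhead_tc ?vhead_hc // E3.
have [E1 E2 E3] := rhoP og.
by split=> //; rewrite ?E3 // ?vhead_tc ?vhead_hc // E3.
Qed.

Lemma vert_tc_inj (s t : bool * O) : (lab s.2).1 = g -> (lab t.2).1 = g ->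
  vert s.1 (tc s.2) = vert t.1 (tc t.2) -> t = s \/ t = gmate s.
Proof.
case: s t => [b o] [b' o'] /= og og'; rewrite /vert !vhead_tc //.
have [[E1 _ _] [E1' _ _]] := (lamP og, lamP og').
case: b; case: b' => E.
- by left; congr pair; apply/esym/lam_inj => //; apply: lam_inj.
- by right; rewrite /gmate /=; congr pair; apply/esym/lam_inj.
- by right; rewrite /gmate /= (lam_inj og E1' E); case: (lamP og') => _ _ ->.
- by left; congr pair; apply/esym/lam_inj.
Qed.

Lemma vert_hc_inj (s t : bool * O) : (lab s.2).1 = g -> (lab t.2).1 = g ->
  vert s.1 (hc s.2) = vert t.1 (hc t.2) -> t = s \/ t = gmate s.
Proof.
case: s t => [b o] [b' o'] /= og og'; rewrite /vert !vhead_hc //.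
case: b; case: b' => E.
- by left; congr pair; apply/esym/lam_inj.
- by right; rewrite /gmate /= E.
- by right; rewrite /gmate /= E; case: (lamP og') => _ _ ->.
- by left; congr pair.
Qed.

(** The tail of [rho o] is matched with the head of [o] and so is a break; by [long] its head is not
    one. *)
Lemma rho_nbrk o : (lab o).1 = g -> brk (hc o) -> ~~ brk (hc (rho o)).
Proof.
move=> og b; have [E1 E2 _] := rhoP og; have := long E1.
by rewrite E2 N_brk b andbT.
Qed.

(* Breaks are at least two apart, so after the shift by one those of the two
   copies never face each other. *)
Lemma vert_brk b b' k k' : brk k -> brk k' -> vert b k = vert b' k' ->
  b' = b /\ (k' = k \/ k' = N k).
Proof.
move=> bk bk'; have [E H] := vheadP (touch_brk bk); have [E' H'] := vheadP (touch_brk bk').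
have B : brk (hc (vhead k)) by case: H => ->; rewrite ?N_brk.
have B' : brk (hc (vhead k')) by case: H' => ->; rewrite ?N_brk.
have key : vhead k = vhead k' -> k' = k \/ k' = N k.
  move=> Ev; rewrite -Ev in H'; case: H => E1; case: H'; rewrite E1 => E2.
  - by left.
  - by right; rewrite E2 NK.
  - by right.
  - by left; rewrite -[k']NK -E2 NK.
rewrite /vert; case: b b' => [] [] Ev.
- by split=> //; apply: key; apply: lam_inj.
- case/negP: (rho_nbrk E' B'); rewrite -Ev.
  by have [_ _ ->] := lamP E.
- case/negP: (rho_nbrk E B); rewrite Ev.
  by have [_ _ ->] := lamP E'.
- by split=> //; apply: key.
Qed.

End Generator.
End Matching.

(** * Criteria for gluing two copies of the polygon *)

Variables (w : freegroup 2) (pos : O -> nat).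
Hypothesis w_red : cyclically_reduced w.
Hypothesis pos_lt : forall o, pos o < size (fgval w).
Hypothesis pos_nx : forall o, pos (nx o) = (pos o).+1 %% size (fgval w).
Hypothesis labE : forall o x0, lab o = nth x0 (fgval w) (pos o).

Let nxt2 (s : bool * O) := (s.1, nx s.2).
Let prv2 (s : bool * O) := (s.1, pv s.2).
Let lab2 (s : bool * O) := lab s.2.
Let plus : 'I_2 -> bool := fun _ => true.

Lemma tail_corner (X : eqType) (Vc : 'I_2 -> bool -> O -> X) g s :
  tail_vertex nxt2 lab2 plus (fun g s => Vc g s.1 (pv s.2)) g s = Vc g s.1 (tc s.2).
Proof. by rewrite /tail_vertex /fwd /tc /lab2 eqb_id; case: ifP => //=; rewrite nxK. Qed.

Lemma head_corner (X : eqType) (Vc : 'I_2 -> bool -> O -> X) g s :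
  head_vertex nxt2 lab2 plus (fun g s => Vc g s.1 (pv s.2)) g s = Vc g s.1 (hc s.2).
Proof. by rewrite /head_vertex /fwd /hc /lab2 eqb_id; case: ifP => //=; rewrite nxK. Qed.

Lemma head_turn_brk s :
  ((head_turn nxt2 prv2 lab2 plus s).1 == (lab2 s).1) = ~~ brk (hc s.2).
Proof.
rewrite /head_turn /fwd /lab2 /plus eqb_id /brk /hc negbK; case: ifP => //= _.
by rewrite pvK eq_sym.
Qed.

(** [Vc g b k] names the corner [k] of the copy [b]. Branching becomes a break that faces the inside
    of a syllable: there one turn changes the generator and the other does not. *)
Lemma polygonal_copies (X : eqType) (mt : bool * O -> bool * O) (Vc : 'I_2 -> bool -> O -> X) :
    involutive mt -> (forall s, mt s != s) ->
    (forall s, (lab (mt s).2).1 = (lab s.2).1) ->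
    (forall g s, Vc g (mt s).1 (tc (mt s).2) = Vc g s.1 (tc s.2)) ->
    (forall g s, Vc g (mt s).1 (hc (mt s).2) = Vc g s.1 (hc s.2)) ->
    (forall s t, (lab s.2).1 = (lab t.2).1 ->
      Vc (lab s.2).1 s.1 (tc s.2) = Vc (lab s.2).1 t.1 (tc t.2) -> t = s \/ t = mt s) ->
    (forall s t, (lab s.2).1 = (lab t.2).1 ->
      Vc (lab s.2).1 s.1 (hc s.2) = Vc (lab s.2).1 t.1 (hc t.2) -> t = s \/ t = mt s) ->
    (exists s, brk (hc s.2) && ~~ brk (hc (mt s).2)) ->
  polygonal w.
Proof.
move=> mtK mt_neq gen_mt tail_mt head_mt tail_inj head_inj [s0 /andP[s0b s0b']].
apply: (@polygonal_gluing _ w _ _ predT nxt2 prv2 mt (pos \o snd) lab2 plus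
  (fun g s => Vc g s.1 (pv s.2))) => //=.
- by move=> [b o] _; rewrite /nxt2 /prv2 /= nxK.
- by move=> s x0; apply: labE.
- by move=> s _; apply: gen_mt.
- by move=> g s _; rewrite !tail_corner.
- by move=> g s _; rewrite !head_corner.
- by move=> s t _ _; rewrite !tail_corner; apply: tail_inj.
- by move=> s t _ _; rewrite !head_corner; apply: head_inj.
exists s0 => //; apply/eqP => E; have := head_turn_brk (mt s0).
by rewrite E /lab2 gen_mt [_ == _]head_turn_brk s0b s0b'.
Qed.

(** The two balances are linear relations between the sizes of the four joint types; together they
    make each type as frequent as the opposite one. *)
Lemma flip_matching (U : finType) (A : {pred U}) (h1 h2 : pred U) :
    #|[pred u | (u \in A) && h1 u]| = #|[pred u | (u \in A) && ~~ h1 u]| ->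
    #|[pred u | (u \in A) && h2 u]| = #|[pred u | (u \in A) && ~~ h2 u]| ->
  exists f : U -> U, [/\ {homo f : u / u \in A}, {in A, cancel f f},
    {in A, forall u, h1 (f u) = ~~ h1 u} & {in A, forall u, h2 (f u) = ~~ h2 u}].
Proof.
pose key u := (h1 u, h2 u); pose kap (k : bool * bool) := (~~ k.1, ~~ k.2).
pose c x y := #|[pred u in A | key u == (x, y)]|.
have split1 x : #|[pred u | (u \in A) && (h1 u == x)]| = c x true + c x false.
  rewrite -(cardID h2); congr (_ + _); apply: eq_card => u;
    rewrite !inE -!topredE /= /key xpair_eqE; case: (h2 u); rewrite ?andbT ?andbF //=.
have split2 x : #|[pred u | (u \in A) && (h2 u == x)]| = c true x + c false x.
  rewrite -(cardID h1); congr (_ + _); apply: eq_card => u;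
    rewrite !inE -!topredE /= /key xpair_eqE; case: (h1 u); rewrite ?andbT ?andbF //=.
have pos_eq (h : pred U) : #|[pred u | (u \in A) && h u]| = #|[pred u | (u \in A) && (h u == true)]|.
  by apply: eq_card => u; rewrite !inE eqb_id.
have neg_eq (h : pred U) : #|[pred u | (u \in A) && ~~ h u]| = #|[pred u | (u \in A) && (h u == false)]|.
  by apply: eq_card => u; rewrite !inE eqbF_neg.
rewrite (pos_eq h1) (neg_eq h1) (pos_eq h2) (neg_eq h2) !split1 !split2 => E1 E2.
have [||f [f1 f2 f3]] := @fiber_matching U A _ key kap.
- by case=> [] [] [].
- by move=> [x y]; rewrite /kap /= -!/(c _ _); case: x; case: y => /=; lia.
by exists f; split=> // u /f3[].
Qed.

Lemma oth_neq (g : 'I_2) : rev_ord g != g.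
Proof. by rewrite -val_eqE /=; case: g => [[|[]]]. Qed.

(** One matching of breaks, flipping the types for both generators, serves the circles of both. A
    corner not touched by [g] still needs a name for [g], constant along the gluing of the other
    generator. *)
Lemma polygonal_long :
  (forall o, ~~ (brk o && brk (pv o))) -> (exists o, brk o) -> polygonal w.
Proof.
move=> gap [k0 k0b].
have [f [fA fK f0 f1]] := flip_matching (card_brk_head ord0) (card_brk_head ord_max).
pose N k := if brk k then f k else k.
have N_brk k : brk (N k) = brk k.
  by rewrite /N; case: ifP => // b; apply: fA.
have NK : involutive N.
  by move=> k; rewrite {1}/N N_brk; case: ifP => b; rewrite /N b ?fK.
have N_nbrk k : ~~ brk k -> N k = k by rewrite /N => /negbTE ->.
have N_flip g k : brk k -> has_head g (N k) = ~~ has_head g k.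
  move=> b; rewrite /N b; have [->|g1] := eqVneq g ord0; first exact: f0.
  have -> : g = ord_max by apply: (@gen2P ord0).
  exact: f1.
have long g o : (lab o).1 = g -> ~~ (brk (hc o) && brk (tc o)).
  by move=> _; have := gap o; rewrite /hc /tc; case: ifP; rewrite // andbC.
(* [J] translates the name [v] for the other generator: it looks for a break of the first copy at
   that vertex, then of the second, and gives [None] if both copies are inside syllables. *)
pose J g v := if brk (hc v) then Some (vhead N g (hc v))
  else if brk (hc (rho N (rev_ord g) v)) then
    Some (lam N g (vhead N g (hc (rho N (rev_ord g) v)))) else None.
pose Vc g b k := if touch g k then Some (vert N g b k) else J g (vert N (rev_ord g) b k).
have touch_oth g k : ~~ touch g k -> touch (rev_ord g) k.
  by rewrite !touchE negb_or => /andP[hg _]; rewrite (gen2P hg (oth_neq g)) eqxx.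
(* The two tests in [J] cannot compete: by [long], a break of the second copy does not face a break
   of the first. *)
have Jbrk g b k : brk k -> J g (vert N (rev_ord g) b k) = Some (vert N g b k).
  move=> bk; have [E H] := vheadP N_nbrk (N_flip (rev_ord g)) (touch_brk (rev_ord g) bk).
  have [B Ev] : brk (hc (vhead N (rev_ord g) k)) /\
      vhead N g (hc (vhead N (rev_ord g) k)) = vhead N g k.
    by case: H => ->; rewrite ?N_brk ?bk // (vhead_N NK N_nbrk (N_flip g) bk).
  rewrite /vert /J; case: b; last by rewrite B Ev.
  have [E1 E2 ->] := lamP NK N_nbrk (N_flip (rev_ord g)) E.
  rewrite B Ev E2 N_brk; case: ifP => // B'.
  by have := long _ _ E; rewrite B B'.
have VJ g b k : touch (rev_ord g) k -> Vc g b k = J g (vert N (rev_ord g) b k).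
  rewrite /Vc; case: ifP => // t1 t2; have [bk|] := boolP (brk k); first by rewrite Jbrk.
  rewrite /brk negbK => /eqP E; move: t1 t2; rewrite !touchE E !orbb => /eqP <- /eqP E'.
  by have := oth_neq (lab k).1; rewrite -E' eqxx.
have Vg g b k : touch g k -> Vc g b k = Some (vert N g b k) by rewrite /Vc => ->.
pose mt s := gmate N (lab s.2).1 s.
have mtP s := gmateP NK N_nbrk (N_flip (lab s.2).1) (erefl (lab s.2).1).
have [o [ob og]] : exists o, brk (hc o) /\ (lab o).1 = ord0.
  have [E H] := vheadP N_nbrk (N_flip ord0) (touch_brk ord0 k0b).
  by exists (vhead N ord0 k0); split=> //; case: H => ->; rewrite ?N_brk.
apply: (@polygonal_copies _ mt Vc).
- by move=> s; have [E1 E2 _ _] := mtP s; rewrite /mt E2.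
- by case=> [[] o']; apply/eqP => -[].
- by move=> s; have [] := mtP s.
- move=> g s; have [_ E2 E3 _] := mtP s; have [E|ne] := eqVneq (lab s.2).1 g.
    by subst g; rewrite !Vg ?touch_tc // [vert _ _ _ _]E3.
  have {}ne : (lab s.2).1 = rev_ord g by apply: gen2P ne (oth_neq g).
  by rewrite !VJ ?touch_tc -?ne // [vert _ _ _ _]E3.
- move=> g s; have [_ E2 _ E3] := mtP s; have [E|ne] := eqVneq (lab s.2).1 g.
    by subst g; rewrite !Vg ?touch_hc // [vert _ _ _ _]E3.
  have {}ne : (lab s.2).1 = rev_ord g by apply: gen2P ne (oth_neq g).
  by rewrite !VJ ?touch_hc -?ne // [vert _ _ _ _]E3.
- move=> s t E; rewrite !Vg ?touch_tc // => -[].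
  exact: (vert_tc_inj NK N_nbrk (N_flip _)).
- move=> s t E; rewrite !Vg ?touch_hc // => -[].
  exact: (vert_hc_inj NK N_nbrk (N_flip _)).
exists (false, o); rewrite /= ob /mt /gmate /= og.
exact: (rho_nbrk NK N_nbrk N_brk (N_flip ord0) (long ord0)).
Qed.

(** Letters of the other generator are glued in pairs within each copy by [mu]; since [mu] flips the
    types at both ends, it induces a matching [N] of the breaks. Every corner touches [g], so the
    names for [g] serve both generators. *)
Lemma polygonal_isolated g :
    (forall o, (lab o).1 = g -> ~~ (brk o && brk (pv o))) ->
    (forall o, (lab o).1 != g -> brk o && brk (pv o)) ->
    #|[pred o | ((lab o).1 != g) && has_head g (tc o)]| =
      #|[pred o | ((lab o).1 != g) && ~~ has_head g (tc o)]| ->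
    #|[pred o | ((lab o).1 != g) && has_head g (hc o)]| =
      #|[pred o | ((lab o).1 != g) && ~~ has_head g (hc o)]| ->
    (exists o, brk o) ->
  polygonal w.
Proof.
move=> gap iso bal_tc bal_hc [k0 k0b].
have [mu [muA muK mu_tc mu_hc]] :=
  @flip_matching O [pred o | (lab o).1 != g] (has_head g \o tc) (has_head g \o hc) bal_tc bal_hc.
(* The letter of the other generator at the break [k], which ends or begins there. *)
pose bs k := if (lab k).1 == g then nx k else k.
have bs_pv y : (lab y).1 != g -> bs (pv y) = y.
  move=> yg; have /andP[_] := iso y yg; rewrite /brk pvK /bs => ne.
  suff -> : (lab (pv y)).1 = g by rewrite eqxx pvK.
  by apply: (@gen2P (lab y).1); rewrite eq_sym.
have bs_id y : (lab y).1 != g -> bs y = y by rewrite /bs => /negbTE ->.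
have bs_hc y : (lab y).1 != g -> bs (hc y) = y.
  by rewrite /hc; case: ifP => _ /[dup] yg; [move/bs_id | move/bs_pv].
have bs_tc y : (lab y).1 != g -> bs (tc y) = y.
  by rewrite /tc; case: ifP => _ /[dup] yg; [move/bs_pv | move/bs_id].
have brk_hc y : (lab y).1 != g -> brk (hc y).
  by move=> /iso /andP[]; rewrite /hc; case: ifP.
have brk_tc y : (lab y).1 != g -> brk (tc y).
  by move=> /iso /andP[]; rewrite /tc; case: ifP.
have hc_tc y : (lab y).1 != g -> hc y != tc y.
  move=> /iso /andP[_ b]; have : y != pv y.
    by apply: contraTneq b => E; rewrite /brk pvK -E negbK.
  by rewrite /hc /tc; case: ifP => // _; rewrite eq_sym.
have bsP k : brk k -> exists2 y, (lab y).1 != g & k = hc y \/ k = tc y.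
  move=> b; exists (bs k).
    rewrite /bs; case: ifP => [/eqP <- // | /negbT //].
  rewrite /bs; case: ifP => _; rewrite /hc /tc ?nxK; case: ifP => _; auto.
pose N k := if brk k then (if hc (bs k) == k then hc (mu (bs k)) else tc (mu (bs k))) else k.
have N_hc y : (lab y).1 != g -> N (hc y) = hc (mu y).
  by move=> yg; rewrite /N brk_hc // bs_hc // eqxx.
have N_tc y : (lab y).1 != g -> N (tc y) = tc (mu y).
  by move=> yg; rewrite /N brk_tc // bs_tc // (negbTE (hc_tc y yg)).
have N_nbrk k : ~~ brk k -> N k = k by rewrite /N => /negbTE ->.
have N_brk k : brk (N k) = brk k.
  have [b|nb] := boolP (brk k); last by rewrite N_nbrk // (negbTE nb).
  have [y yg [] ->] := bsP k b; have muyg := muA y yg.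
    by rewrite N_hc // !brk_hc.
  by rewrite N_tc // !brk_tc.
have NK : involutive N.
  move=> k; have [b|/N_nbrk E] := boolP (brk k); last by rewrite !E.
  have [y yg [] ->] := bsP k b; have muyg := muA y yg.
    by rewrite !N_hc // muK.
  by rewrite !N_tc // muK.
have N_flip k : brk k -> has_head g (N k) = ~~ has_head g k.
  move=> b; have [y yg [] ->] := bsP k b; first by rewrite N_hc //; apply: mu_hc.
  by rewrite N_tc //; apply: mu_tc.
have long o : (lab o).1 = g -> ~~ (brk (hc o) && brk (tc o)).
  by move=> /gap; rewrite /hc /tc; case: ifP; rewrite // andbC.
pose mt s := if (lab s.2).1 == g then gmate N g s else (s.1, mu s.2).
have mt_g s : (lab s.2).1 = g -> mt s = gmate N g s by rewrite /mt => ->; rewrite eqxx.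
have mt_ng s : (lab s.2).1 != g -> mt s = (s.1, mu s.2) by rewrite /mt => /negbTE ->.
have gP := gmateP NK N_nbrk N_flip.
have [o [ob og]] : exists o, brk (hc o) /\ (lab o).1 = g.
  have [E H] := vheadP N_nbrk N_flip (touch_brk g k0b).
  by exists (vhead N g k0); split=> //; case: H => ->; rewrite ?N_brk.
apply: (@polygonal_copies _ mt (fun _ => vert N g)).
- move=> s; have [E|ne] := eqVneq (lab s.2).1 g.
    by have [E1 E2 _ _] := gP s E; rewrite mt_g // mt_g.
  by rewrite (mt_ng s) // mt_ng ?muK //=; [case: (s) | apply: muA].
- move=> s; have [E|ne] := eqVneq (lab s.2).1 g.
    by rewrite mt_g //; case: s E => [[] o'] _; apply/eqP => -[].
  rewrite mt_ng //; apply/eqP => /(congr1 (fun s => has_head g (tc s.2))) /=.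
  by rewrite -[X in X = _]/((has_head g \o tc) _) mu_tc //=; case: has_head.
- move=> s; have [E|ne] := eqVneq (lab s.2).1 g.
    by have [_ E2 _ _] := gP s E; rewrite mt_g // E2.
  by rewrite mt_ng //=; apply: gen2P (muA _ ne) ne.
- move=> h s; have [E|ne] := eqVneq (lab s.2).1 g.
    by have [_ _ E2 _] := gP s E; rewrite mt_g // E2.
  by rewrite mt_ng //= -N_tc // /vert (vhead_N NK N_nbrk N_flip) ?brk_tc.
- move=> h s; have [E|ne] := eqVneq (lab s.2).1 g.
    by have [_ _ _ E2] := gP s E; rewrite mt_g // E2.
  by rewrite mt_ng //= -N_hc // /vert (vhead_N NK N_nbrk N_flip) ?brk_hc.
- move=> [c1 y] [c2 z] /= Est; have [E|ne] := eqVneq (lab y).1 g.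
    by rewrite mt_g //; apply: (@vert_tc_inj N NK N_nbrk g N_flip (c1, y) (c2, z)); rewrite /= -?Est.
  have ne' : (lab z).1 != g by rewrite -Est.
  move=> /(vert_brk NK N_nbrk N_brk N_flip long (brk_tc _ ne) (brk_tc _ ne'))[-> H].
  have muy : (lab (mu y)).1 != g by apply: muA.
  rewrite mt_ng //=; move: H; rewrite N_tc // => -[] /(congr1 bs).
    by rewrite !bs_tc // => ->; left.
  by rewrite !bs_tc // => ->; right.
- move=> [c1 y] [c2 z] /= Est; have [E|ne] := eqVneq (lab y).1 g.
    by rewrite mt_g //; apply: (@vert_hc_inj N NK N_nbrk g N_flip (c1, y) (c2, z)); rewrite /= -?Est.
  have ne' : (lab z).1 != g by rewrite -Est.
  move=> /(vert_brk NK N_nbrk N_brk N_flip long (brk_hc _ ne) (brk_hc _ ne'))[-> H].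
  have muy : (lab (mu y)).1 != g by apply: muA.
  rewrite mt_ng //=; move: H; rewrite N_hc // => -[] /(congr1 bs).
    by rewrite !bs_hc // => ->; left.
  by rewrite !bs_hc // => ->; right.
exists (false, o); rewrite /= ob mt_g //=.
exact: (rho_nbrk NK N_nbrk N_brk N_flip long).
Qed.

End Corners.

(** * Simple height-one words *)

Lemma card_bijection (U : finType) (A B : {pred U}) : #|A| = #|B| ->
  exists f g : U -> U, [/\ {homo f : u / u \in A >-> u \in B},
    {homo g : u / u \in B >-> u \in A}, {in A, cancel f g} & {in B, cancel g f}].
Proof.
have main (A1 A2 : {pred U}) : #|A1| = #|A2| ->
    let f u := nth u (enum A2) (index u (enum A1)) in
    let g u := nth u (enum A1) (index u (enum A2)) in
    {homo f : u / u \in A1 >-> u \in A2} /\ {in A1, cancel f g}.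
  rewrite !fintype.cardE => E; have ltA u : u \in A1 -> index u (enum A1) < size (enum A2).
    by rewrite -E index_mem mem_enum.
  split=> u uA; first by rewrite -mem_enum mem_nth // ltA.
  rewrite index_uniq ?enum_uniq ?ltA //.
  by rewrite (set_nth_default u) ?nth_index ?index_mem ?mem_enum.
move=> E; have [fA fK] := main A B E; have [gB gK] := main B A (esym E).
by exists (fun u => nth u (enum B) (index u (enum A))),
  (fun u => nth u (enum A) (index u (enum B))).
Qed.

Lemma card_ord_lt n b : b <= n -> #|[pred i : 'I_n | i < b]| = b.
Proof.
move=> le_b; have wi : injective (widen_ord le_b) by move=> i j /(congr1 val) /= /val_inj.
rewrite -[RHS]card_ord -(card_image wi 'I_b).
apply: eq_card => i; rewrite inE; apply/idP/imageP => [lt_i | [j _ ->]].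
  by exists (Ordinal lt_i) => //; apply: val_inj.
by rewrite /= ltn_ord.
Qed.

Section Circuits.
Variables (m : nat) (len : 'I_m -> nat).
Hypothesis len_gt0 : forall k, 0 < len k.
Local Notation O := (slot len).
Local Notation fs := (fst_ len_gt0).
Local Notation ls := (lst len_gt0).
Local Notation nx := (nx len_gt0).
Local Notation pv := (pv len_gt0).

(** Motion along circles made of whole syllables, the syllable [k] being followed by [h k]; [circV]
    is the backward motion when given the inverse of [h]. *)
Definition circ (h : 'I_m -> 'I_m) (o : O) : O :=
  if o == ls (syl o) then fs (h (syl o)) else nx o.
Definition circV (h : 'I_m -> 'I_m) (o : O) : O :=
  if o == fs (syl o) then ls (h (syl o)) else pv o.

Lemma nx_neq_fst o : o != ls (syl o) -> nx o != fs (syl o).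
Proof.
apply: contraNneq => /(congr1 pv); rewrite nxK pv_fst => E.
have E' : syl o = ord_pred (syl o) := congr1 (@syl m len) E.
by rewrite E' -E.
Qed.

Lemma circK h h' : cancel h h' -> cancel (circ h) (circV h').
Proof.
move=> hK o; rewrite /circ; case: ifPn => [/eqP E | ne]; rewrite /circV.
  by rewrite syl_fst eqxx hK -E.
by rewrite syl_nx // (negbTE (nx_neq_fst ne)) nxK.
Qed.

Lemma circVK h h' : cancel h h' -> cancel (circV h') (circ h).
Proof. by move=> /circK/canF_sym. Qed.

Lemma slot_len1 o : len (syl o) = 1 -> o = fs (syl o).
Proof.
case: (slotP len_gt0 o) => k [t [lt_t ->]] E; rewrite [syl _]/= in E *.
by move: lt_t; rewrite E ltnS leqn0 => /eqP ->.
Qed.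

End Circuits.

(** * The surface of a simple height-one word *)

Section HeightOne.
Variables (m : nat) (c : 'I_m -> letter 2) (len : 'I_m -> nat).
Hypothesis len_gt0 : forall k, 0 < len k.
(* The syllables follow the cyclic pattern [p], [b^-1], [q], [b], recorded by
   [kd] = 0, 1, 2, 3; shifting [kd] by two exchanges the roles of [p] and [q]. *)
Variables (a b : 'I_2) (sp sq sb : bool) (kd : 'I_m -> nat).
Hypothesis ab : a != b.
Hypothesis kd_lt : forall k, kd k < 4.
Hypothesis kdS : forall k, kd (ordS k) = (kd k).+1 %% 4.
Hypothesis c0 : forall k, kd k = 0 -> c k = (a, sp).
Hypothesis c1 : forall k, kd k = 1 -> c k = (b, ~~ sb).
Hypothesis c2 : forall k, kd k = 2 -> c k = (a, sq).
Hypothesis c3 : forall k, kd k = 3 -> c k = (b, sb).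
Hypothesis len1 : forall k, kd k = 1 -> len k = 1.
Hypothesis len3 : forall k, kd k = 3 -> len k = 1.

Local Notation O := (slot len).
Local Notation fs := (fst_ len_gt0).
Local Notation ls := (lst len_gt0).
Local Notation nx := (nx len_gt0).
Local Notation pv := (pv len_gt0).

Let kdo (o : O) := kd (syl o).

Lemma kd_pred k : kd k = (kd (ord_pred k)).+1 %% 4.
Proof. by rewrite -kdS ord_predK. Qed.

Lemma kd_cases k : [\/ kd k = 0, kd k = 1, kd k = 2 | kd k = 3].
Proof. by move: (kd_lt k); case: (kd k) => [|[|[|[]]]] // _; [apply: Or41 | apply: Or42 | apply: Or43 | apply: Or44]. Qed.

Variables (n0 beta : nat).
Hypothesis n0_gt0 : 0 < n0.
Hypothesis beta_le : beta <= n0.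
Hypothesis balance : #|[pred o | kdo o == 0]| * n0 =
  #|[pred o | (kdo o == 2) && (len (syl o) == 1)]| * n0 +
  #|[pred o | (kdo o == 2) && (len (syl o) != 1)]| * beta.

Local Notation C := ('I_n0 * bool)%type.

Definition pidx : pred (O * C) := [pred z | kdo z.1 == 0].
(** One-letter [q]-syllables always face [p]-letters, since they cannot be glued among themselves
    with a shift. The other [q]-syllables do so in [beta] out of [n0] classes of copies, each class
    being doubled by the boolean. *)
Definition inpq (y : O) (i : C) := (len (syl y) == 1) || (i.1 < beta).
Definition qidx : pred (O * C) := [pred z | (kdo z.1 == 2) && inpq z.1 z.2].

Lemma card_idx : #|pidx| = #|qidx|.
Proof.
have C2 (A : {pred O}) (B : pred 'I_n0) :
    #|[pred z : O * C | (z.1 \in A) && B z.2.1]| = #|A| * (#|B| * 2).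
  rewrite -card_bool -!cardX; apply: eq_card => -[o [i j]].
  by rewrite !inE /= andbT.
have E0 := C2 [pred o | kdo o == 0] predT.
have E1 := C2 [pred o | (kdo o == 2) && (len (syl o) == 1)] predT.
have E2 := C2 [pred o | (kdo o == 2) && (len (syl o) != 1)] [pred i : 'I_n0 | i < beta].
rewrite card_ord in E0; rewrite card_ord in E1; rewrite card_ord_lt // in E2.
transitivity (#|[pred o | kdo o == 0]| * (n0 * 2)).
  by rewrite -E0; apply: eq_card => z; rewrite !inE andbT.
rewrite mulnA balance mulnDl -!mulnA -E1 -E2 -(cardID [pred z | len (syl z.1) == 1] qidx).
by congr (_ + _); apply: eq_card => z; rewrite !inE /inpq -?topredE /= ?andbT;
  case: (_ == 1); rewrite ?andbF ?andbT //.
Qed.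

(** Whether [p]- and [q]-letters point the same way; if not, facing circles are traversed in
    opposite directions. This decides the sense of every rotation below. *)
Let e := sp == sq.
Definition rotp (t : bool) := if t then circ len_gt0 (iter 4 (@ordS m)) else circV len_gt0 (iter 4 (@ord_pred m)).
Definition rotq (t : bool) := if t then circ len_gt0 id else circV len_gt0 id.

Arguments rotp : simpl never.
Arguments rotq : simpl never.

Lemma iterSK : cancel (iter 4 (@ordS m)) (iter 4 (@ord_pred m)).
Proof. by move=> k; rewrite /= !ordSK. Qed.

Lemma rotpK t : cancel (rotp t) (rotp (~~ t)).
Proof. by case: t; [apply: circK iterSK | apply: circVK iterSK]. Qed.

Lemma rotqK t : cancel (rotq t) (rotq (~~ t)).
Proof. by case: t; [apply: circK | apply: circVK]. Qed.

Lemma syl_rotq t o : syl (rotq t o) = syl o.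
Proof.
have main o' : syl (rotq true o') = syl o'.
  by rewrite /rotq /circ; case: ifPn => // /syl_nx.
by case: t => //; rewrite -[in RHS](rotqK false o) main.
Qed.

Lemma kd_rotp t o : kdo (rotp t o) = kdo o.
Proof.
have main o' : kdo (rotp true o') = kdo o'.
  rewrite /rotp /circ /kdo; case: ifPn => [_ | /syl_nx -> //].
  by rewrite syl_fst /= !kdS; case: (kd_cases (syl o')) => ->.
by case: t => //; rewrite -[in RHS](rotpK false o) main.
Qed.

Lemma kd_rotq t o : kdo (rotq t o) = kdo o.
Proof. by rewrite /kdo syl_rotq. Qed.

Lemma inpq_rotq t o i : inpq (rotq t o) i = inpq o i.
Proof. by rewrite /inpq syl_rotq. Qed.

(** Thanks to this, [q]-sides glued with a shift never put two first letters, where the [b]-edges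
    are attached, face to face. *)
Lemma rotq_fst t k : len k != 1 -> rotq t (fs k) != fs (syl (rotq t (fs k))).
Proof.
rewrite syl_rotq syl_fst => ne; have ne' : fs k != ls k by rewrite fst_lst.
case: t; rewrite /rotq /circ /circV syl_fst ?eqxx; last by rewrite eq_sym.
by rewrite (negbTE ne'); apply: nx_neq_fst.
Qed.

Variables (F G : O * C -> O * C).
Hypothesis F_in : {homo F : z / z \in pidx >-> z \in qidx}.
Hypothesis G_in : {homo G : z / z \in qidx >-> z \in pidx}.
Hypothesis FK : {in pidx, cancel F G}.
Hypothesis GK : {in qidx, cancel G F}.

(* The copies of a letter are indexed by [pidx], i.e. by a position of a
   [p]-letter and a copy number; [F] translates this into a [q]-position and a
   copy number.  The [p]-side at [x] of index [(y, i)] faces the [q]-side at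
   [y] of index [(x, i)]; the [q]-sides that are not [inpq] face each other. *)
Definition copy_side : finType := (O * (O * C))%type.
Definition vertex_name : finType := (bool * (O * (O * C)))%type.
Definition dom : pred copy_side := [pred s | s.2 \in pidx].

(** Reading a [p]-letter moves the facing position along its [q]-circle, and reading a [q]-letter
    moves the facing [p]-position. The index thus varies along a polygon, which may close up only
    after several readings of [w]. *)
Definition stepp t z := G (rotq (t == e) (F z).1, (F z).2).
Definition stepq t (z : O * C) := (rotp (t == e) z.1, z.2).
Definition step t (o : O) z :=
  match kdo o with 0 => stepp t z | 2 => stepq t z | _ => z end.

Definition nxt (s : copy_side) : copy_side := (nx s.1, step true s.1 s.2).
Definition prv (s : copy_side) : copy_side := (pv s.1, step false (pv s.1) s.2).

Definition vp (x : O) z : vertex_name := (true, (x, F z)).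
(** A [q]-side facing a [p]-side starts at the tail of the edge if [e] holds and at its head
    otherwise, hence the step along the [p]-circle. For two [q]-sides facing each other the one
    marked [false] gives the name. *)
Definition vq (y : O) (z : O * C) : vertex_name :=
  if inpq y z.2 then
    if e then (true, (z.1, (y, z.2))) else (true, (rotp true z.1, (rotq false y, z.2)))
  else if z.2.2 then (false, (rotq false y, (rotp (~~ e) z.1, (z.2.1, false))))
  else (false, (y, z)).

(** A side of kind 1 starts on the [p]-circle, where the next [p]-syllable begins; a side of kind 3
    starts on the circle of the [q]-syllable just read, where that syllable begins. *)
Definition vtx (s : copy_side) : vertex_name :=
  let k := syl s.1 in
  match kd k with
  | 0 => vp s.1 s.2
  | 1 => vp (fs (ordS (ordS (ordS k)))) s.2
  | 2 => vq s.1 s.2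
  | _ => vq (fs (ord_pred k)) s.2
  end.

Definition mtq (y : O) (z : O * C) : copy_side :=
  if inpq y z.2 then (z.1, G (y, z.2))
  else (rotq (~~ z.2.2) y, (rotp (z.2.2 != e) z.1, (z.2.1, ~~ z.2.2))).

Definition mt (s : copy_side) : copy_side :=
  let k := syl s.1 in
  match kd k with
  | 0 => ((F s.2).1, (s.1, (F s.2).2))
  | 1 => (fs (ordS (ordS k)), s.2)
  | 2 => mtq s.1 s.2
  | _ => (fs (ord_pred (ord_pred k)), s.2)
  end.

Lemma idxP z : z \in pidx -> kdo z.1 = 0. Proof. by move/eqP. Qed.
Lemma F_kd z : z \in pidx -> kdo (F z).1 = 2 /\ inpq (F z).1 (F z).2.
Proof. by move/F_in => /andP[/eqP]. Qed.

Lemma stepp_dom t z : z \in pidx -> stepp t z \in pidx.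
Proof.
by move=> /F_kd[E1 E2]; apply: G_in; rewrite inE /= kd_rotq inpq_rotq E1 E2.
Qed.

Lemma stepp_F t z : z \in pidx -> F (stepp t z) = (rotq (t == e) (F z).1, (F z).2).
Proof.
by move=> /F_kd[E1 E2]; rewrite GK // inE /= kd_rotq inpq_rotq E1 E2.
Qed.

Lemma step_dom t o z : z \in pidx -> step t o z \in pidx.
Proof.
rewrite /step => zp; case: (kd_cases (syl o)); rewrite -/(kdo o) => -> //.
  exact: stepp_dom.
by rewrite inE /= kd_rotp.
Qed.

Lemma negb_eq_e t : ((~~ t) == e) = ~~ (t == e). Proof. by case: t; case: e. Qed.

Lemma stepK o z : z \in pidx -> step false o (step true o z) = z.
Proof.
rewrite /step => zp; case: (kd_cases (syl o)); rewrite -/(kdo o) => -> //.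
  rewrite {1}/stepp stepp_F //= -[false]/(~~ true) negb_eq_e rotqK.
  by rewrite -surjective_pairing FK.
by rewrite /stepq /= -[false]/(~~ true) negb_eq_e rotpK -surjective_pairing.
Qed.

Lemma nxtK : {in dom, cancel nxt prv}.
Proof.
move=> [o z] zp; rewrite /prv /nxt /= nxK stepK //.
Qed.

Lemma len1_slot o : len (syl o) = 1 -> o = fs (syl o) /\ o = ls (syl o).
Proof.
move=> E; have E1 := slot_len1 len_gt0 E; split=> //.
by rewrite {1}E1; apply/eqP; rewrite fst_lst E.
Qed.

Lemma len_kd o : kdo o = 1 \/ kdo o = 3 -> len (syl o) = 1.
Proof. by case=> [/len1 | /len3]. Qed.

Lemma mtq_mtq y z : z \in pidx -> kdo y = 2 -> mt (mtq y z) = (y, z).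
Proof.
move=> zp yk; rewrite /mtq; case: ifPn => iy.
  rewrite /mt /= -/(kdo _) (idxP zp) GK; last by rewrite inE /= yk iy.
  by rewrite -surjective_pairing.
rewrite /mt /= -/(kdo _) kd_rotq yk /mtq /= inpq_rotq.
have -> : inpq y (z.2.1, ~~ z.2.2) = inpq y z.2 by [].
rewrite (negbTE iy) negb_eq_e rotqK rotpK negbK.
by case: z {zp iy} => x [i j].
Qed.

Lemma mtK : {in dom, cancel mt mt}.
Proof.
move=> [o z] zp; rewrite {2}/mt /=; have := kd_cases (syl o).
case=> E; rewrite E /=.
- rewrite /mt /= -/(kdo _); have [-> i] := F_kd zp; rewrite /mtq i /=.
  by rewrite -surjective_pairing FK.
- rewrite /mt /= !kdS E /= !ordSK.
  by have [<-] := len1_slot (len1 E).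
- exact: mtq_mtq.
- rewrite /mt /=; have E2 : kd (ord_pred (ord_pred (syl o))) = 1.
    by move: E; rewrite kd_pred (kd_pred (ord_pred _)); case: (kd_cases (ord_pred (ord_pred (syl o)))) => ->.
  by rewrite E2 /= !ord_predK; have [<-] := len1_slot (len3 E).
Qed.


Definition ori (g : 'I_2) := if g == a then sp else sb.
Definition lab (s : copy_side) : letter 2 := c (syl s.1).

(* An oriented [a]-edge of the surface is named by the positions of its two
   sides, and [adv] moves to the next edge along its circle. *)
Definition edge (s : copy_side) : vertex_name :=
  if kdo s.1 == 0 then vp s.1 s.2
  else let: (y, z) := s in
    if inpq y z.2 then (true, (z.1, (y, z.2)))
    else if z.2.2 then (false, (rotq false y, (rotp (~~ e) z.1, (z.2.1, false))))
    else (false, (y, z)).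
Definition adv (w : vertex_name) : vertex_name :=
  let: (t, (u, (v, i))) := w in
  if t then (true, (rotp true u, (rotq e v, i))) else (false, (rotq true u, (rotp e v, i))).
(** The generator [a] is oriented like the [p]-letters. An edge between two [q]-sides advances in
    the sense of the [q]-letters, so its ends are exchanged when [e] fails. *)
Definition etail w := if w.1 || e then w else adv w.
Definition ehead w := if w.1 || e then adv w else w.

Lemma adv_inj : injective adv.
Proof.
move=> [[] [u [v i]]] [[] [u' [v' i']]] //= [].
  by move=> /(can_inj (rotpK true)) -> /(can_inj (rotqK e)) -> ->.
by move=> /(can_inj (rotqK true)) -> /(can_inj (rotpK e)) -> ->.
Qed.

Lemma adv1 w : (adv w).1 = w.1. Proof. by case: w => [[] [u [v i]]]. Qed.

Lemma etail_inj : injective etail.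
Proof.
move=> w w'; rewrite /etail; do 2!case: ifP => //; last by move=> _ _ /adv_inj.
  by move=> E1 E2 E; move: E1 E2; rewrite E adv1 => ->.
by move=> E1 E2 E; move: E1 E2; rewrite -E adv1 => ->.
Qed.

Lemma ehead_inj : injective ehead.
Proof.
move=> w w'; rewrite /ehead; do 2!case: ifP => //; first by move=> _ _ /adv_inj.
  by move=> E1 E2 E; move: E1 E2; rewrite -E adv1 => ->.
by move=> E1 E2 E; move: E1 E2; rewrite E adv1 => ->.
Qed.

Lemma vq_edge y z : kdo y = 2 -> vq y z = if e then etail (edge (y, z)) else ehead (edge (y, z)).
Proof.
rewrite /edge /= => -> /=; rewrite /vq /etail /ehead.
by case: inpq => /=; case: e => //=; case: (z.2.2).
Qed.

Lemma vq_end y z : kdo y = 2 ->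
  vq (rotq true y) (stepq true z) = if e then ehead (edge (y, z)) else etail (edge (y, z)).
Proof.
rewrite /edge /= => -> /=; rewrite /vq /etail /ehead /stepq /= inpq_rotq.
case: z => x [i j] /=; case: inpq => /=.
  case: e => //=; by rewrite (rotpK false) (rotqK true).
rewrite (rotqK true); case: j => /=.
  case: e => /=; rewrite (rotqK false) ?(rotpK true) ?(rotpK false) //.
by case: e.
Qed.

Lemma vtx_end_q y z : kdo y = 2 -> vtx (nxt (y, z)) = vq (rotq true y) (stepq true z).
Proof.
move=> E; rewrite /vtx /nxt /step /= E /rotq /circ.
case: ifPn => [/eqP Ey | /syl_nx Ey]; last by rewrite Ey -/(kdo y) E.
have -> : nx y = fs (ordS (syl y)) by rewrite {1}Ey nx_lst.
by rewrite syl_fst kdS -/(kdo y) E /= ordSK.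
Qed.

Lemma vtx_end_p x z : kdo x = 0 -> vtx (nxt (x, z)) = vp (rotp true x) (stepp true z).
Proof.
move=> E; rewrite /vtx /nxt /step /= E /rotp /circ.
case: ifPn => [/eqP Ex | /syl_nx Ex]; last by rewrite Ex -/(kdo x) E.
have -> : nx x = fs (ordS (syl x)) by rewrite {1}Ex nx_lst.
by rewrite syl_fst kdS -/(kdo x) E.
Qed.

Let V : 'I_2 -> copy_side -> vertex_name := fun _ => vtx.
Notation tailv := (tail_vertex nxt lab ori V).
Notation headv := (head_vertex nxt lab ori V).

Lemma lab_a s : kdo s.1 = 0 \/ kdo s.1 = 2 -> (lab s).1 = a.
Proof. by rewrite /lab => -[/c0 | /c2] ->. Qed.

Lemma lab_b s : kdo s.1 = 1 \/ kdo s.1 = 3 -> (lab s).1 = b.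
Proof. by rewrite /lab => -[/c1 | /c3] ->. Qed.

Lemma fwd_lab s : fwd ori (lab s) =
  match kdo s.1 with 0 => true | 1 => false | 2 => e | _ => true end.
Proof.
have ba : (b == a) = false by rewrite eq_sym (negbTE ab).
rewrite /fwd /ori /lab /kdo; case: (kd_cases (syl s.1)) => E; rewrite E.
- by rewrite c0 //= eqxx eqxx.
- by rewrite c1 //= ba; case: sb.
- by rewrite c2 //= eqxx eq_sym.
- by rewrite c3 //= ba eqxx.
Qed.

Lemma ends_a g s : s \in dom -> kdo s.1 = 0 \/ kdo s.1 = 2 ->
  tailv g s = etail (edge s) /\ headv g s = ehead (edge s).
Proof.
case: s => [o z] zp; rewrite /tail_vertex /head_vertex fwd_lab /V /=; case=> E.
  rewrite E vtx_end_p //; rewrite /vtx /edge /= -/(kdo o) E /=.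
  split=> //; rewrite /vp stepp_F // /ehead /adv /=.
  by case: (F z).
rewrite E vtx_end_q // /vtx /= -/(kdo o) E vq_edge // vq_end //.
by case: e.
Qed.

(** A [b]-edge joins the beginning of a [q]-syllable, [bq], at its tail to the beginning of the next
    [p]-syllable, [bp], at its head. *)
Definition bq (s : copy_side) := fs (if kdo s.1 == 1 then ordS (syl s.1) else ord_pred (syl s.1)).
Definition bp (s : copy_side) := fs (if kdo s.1 == 1 then ordS (ordS (ordS (syl s.1))) else ordS (syl s.1)).

Lemma ends_b g s : kdo s.1 = 1 \/ kdo s.1 = 3 ->
  tailv g s = vq (bq s) s.2 /\ headv g s = vp (bp s) s.2.
Proof.
case: s => [o z]; rewrite /tail_vertex /head_vertex fwd_lab /V /bq /bp /= => H.
have := len_kd H; move=> /len1_slot [_ Eo].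
have En : nx o = fs (ordS (syl o)) by rewrite {1}Eo nx_lst.
rewrite /nxt /step /=; case: H => E; rewrite E /= En /vtx /= kdS -/(kdo o) E //=.
Qed.

Lemma kd_mt_b s : kdo s.1 = 1 \/ kdo s.1 = 3 ->
  [/\ kdo (mt s).1 = 1 \/ kdo (mt s).1 = 3, bq (mt s) = bq s, bp (mt s) = bp s & (mt s).2 = s.2].
Proof.
case: s => [o z]; rewrite /= /mt /= => H.
have kp : kd (ord_pred (ord_pred (syl o))) = if kdo o == 3 then 1 else 3.
  have : kdo o = ((kd (ord_pred (ord_pred (syl o)))).+1 %% 4).+1 %% 4 by rewrite -!kd_pred.
  by case: H => ->; case: (kd_cases (ord_pred (ord_pred (syl o)))) => ->.
case: H => E; rewrite -/(kdo o) E /bq /bp /kdo /= ?kdS -/(kdo o) E /=.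
  by rewrite ordSK; split=> //; right.
by rewrite kp E /= !ord_predK; split=> //; left.
Qed.

Lemma kd_bq s : kdo s.1 = 1 \/ kdo s.1 = 3 -> kdo (bq s) = 2.
Proof.
case=> E; rewrite /bq /kdo /= -/(kdo _) E /=; first by rewrite kdS -/(kdo _) E.
have : kdo s.1 = (kd (ord_pred (syl s.1))).+1 %% 4 by rewrite -kd_pred.
by rewrite E; case: (kd_cases (ord_pred (syl s.1))) => ->.
Qed.

Lemma mt_dom : {homo mt : s / s \in dom}.
Proof.
move=> [o z]; rewrite !inE => zp; rewrite /mt /=; case: (kd_cases (syl o)) => E; rewrite E //=.
  by rewrite -/(kdo o) /kdo E.
rewrite /mtq; case: ifPn => i; last by rewrite /= kd_rotp.
by apply: G_in; rewrite inE /= /kdo E i.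
Qed.

Lemma edge_mt s : s \in dom -> kdo s.1 = 0 \/ kdo s.1 = 2 -> edge (mt s) = edge s.
Proof.
case: s => [o z]; rewrite inE => zp [] /= E; rewrite /mt /= -/(kdo o) E.
  have [E1 i] := F_kd zp; rewrite /edge /= E1 E /= i /vp.
  by case: (F z).
rewrite {2}/edge /= E /mtq; case: ifPn => i.
  by rewrite /edge /= (idxP zp) /= /vp GK // inE /= E i.
rewrite /edge /= kd_rotq E /= inpq_rotq.
have -> : inpq o (z.2.1, ~~ z.2.2) = inpq o z.2 by [].
rewrite (negbTE i); case: z {i zp} => x [i [|]] /=.
  by case: e.
by rewrite (rotqK true); case: e => /=; rewrite ?(rotpK true) ?(rotpK false).
Qed.

Lemma edge_inj s t : s \in dom -> t \in dom ->
    kdo s.1 = 0 \/ kdo s.1 = 2 -> kdo t.1 = 0 \/ kdo t.1 = 2 ->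
  edge s = edge t -> t = s \/ t = mt s.
Proof.
case: s t => [o z] [o' z']; rewrite !inE => zp zp'.
have Fi u v : u \in pidx -> v \in pidx -> F u = F v -> u = v.
  by move=> up vp E; rewrite -(FK up) E FK.
case=> /= E [] /= E'; rewrite /edge /= E E' /=.
- by rewrite /vp => -[<- /Fi <-] //; left.
- case: ifP => [i|_]; last by case: ifP.
  rewrite /vp => -[Eo EF]; right; rewrite /mt /= -/(kdo o) E EF /=.
  by rewrite Eo -surjective_pairing.
- rewrite /vp; case: ifPn => i; last by case: ifP.
  move=> [Ez EF].
  right; rewrite /mt /= -/(kdo o) E /mtq i /= -Ez; congr (_, _).
  by rewrite EF FK.
case: (boolP (inpq o z.2)) => i; case: (boolP (inpq o' z'.2)) => i' /=;
  [|by case: ifP|by case: ifP|].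
  by move=> [Ez <- Ez2]; left; rewrite (surjective_pairing z') -Ez -Ez2 -surjective_pairing.
rewrite /mt /= -/(kdo o) E /mtq (negbTE i).
case: z zp i => x [j k] zp i; case: z' zp' i' => x' [j' k'] zp' i' /=.
case: k zp i => _ _; case: k' zp' i' => _ _ [].
- by move=> /(can_inj (rotqK false)) -> /(can_inj (rotpK _)) -> ->; left.
- by move=> <- <- <-; right; case: e.
- by move=> -> -> ->; right; rewrite (rotqK false); case: e => /=; rewrite ?(rotpK true) ?(rotpK false).
- by move=> -> -> ->; left.
Qed.

Lemma kd_mt_a s : s \in dom -> kdo s.1 = 0 \/ kdo s.1 = 2 ->
  kdo (mt s).1 = 0 \/ kdo (mt s).1 = 2.
Proof.
case: s => [o z]; rewrite inE /mt /= => zp [] E; rewrite -/(kdo o) E /=.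
  by right; case: (F_kd zp).
rewrite /mtq; case: ifP => _ /=; first by left; apply: idxP.
by right; rewrite kd_rotq.
Qed.

Lemma kdo_cases o : (kdo o = 0 \/ kdo o = 2) \/ (kdo o = 1 \/ kdo o = 3).
Proof. by rewrite /kdo; case: (kd_cases (syl o)) => ->; auto. Qed.

Lemma mt_neq s : s \in dom -> mt s != s.
Proof.
case: s => [o z]; rewrite inE => zp; apply/eqP; rewrite /mt /=.
case: (kd_cases (syl o)) => E; rewrite E => -[].
- by move=> /(congr1 kdo); case: (F_kd zp) => -> _; rewrite /kdo E.
- by move=> /(congr1 kdo); rewrite {1}/kdo /= !kdS E /kdo E.
- rewrite /mtq; case: ifP => _ [].
    by move=> /(congr1 kdo); rewrite (idxP zp) /kdo E.
  by move=> _ /(congr1 (fun z => z.2.2)) /=; case: (z.2.2).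
- move=> /(congr1 kdo); rewrite {1}/kdo /= /kdo.
  have : kd (syl o) = ((kd (ord_pred (ord_pred (syl o)))).+1 %% 4).+1 %% 4 by rewrite -!kd_pred.
  by rewrite E; case: (kd_cases (ord_pred (ord_pred (syl o)))) => ->.
Qed.

Lemma mt_q y z : kdo y = 2 -> mt (y, z) = mtq y z.
Proof. by rewrite /mt /kdo /= => ->. Qed.

(** Equal names give equal or mated [q]-sides. A mate facing a [p]-side is not a [q]-side; a mate by
    shift lies in the same syllable, of length at least two, and is not its first letter. *)
Lemma vq_inj s t : s \in dom -> t \in dom ->
    kdo s.1 = 1 \/ kdo s.1 = 3 -> kdo t.1 = 1 \/ kdo t.1 = 3 ->
  vq (bq s) s.2 = vq (bq t) t.2 -> bq s = bq t /\ s.2 = t.2.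
Proof.
move=> sD tD /kd_bq Es /kd_bq Et; rewrite !vq_edge // => E.
have {}E : edge (bq s, s.2) = edge (bq t, t.2).
  by move: E; case: e => [/etail_inj | /ehead_inj].
case: (@edge_inj (bq s, s.2) (bq t, t.2) sD tD (or_intror Es) (or_intror Et) E).
  by move/eqP; rewrite xpair_eqE => /andP[/eqP -> /eqP ->].
move/(congr1 (fun s => s.1)); rewrite (mt_q _ Es) /mtq.
case: ifPn => i E1; first by move: Et; rewrite [bq t]E1 (idxP sD).
have fE r : bq r = fs (syl (bq r)) by rewrite /bq syl_fst.
have Esyl : syl (bq t) = syl (bq s) by rewrite [bq t]E1 syl_rotq.
have ne : len (syl (bq s)) != 1 by move: i; rewrite negb_or => /andP[].
have := @rotq_fst (~~ s.2.2.2) _ ne.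
by rewrite -fE syl_rotq -Esyl -fE [X in X != _](esym E1) eqxx.
Qed.

Lemma bq_inj s t : kdo s.1 = 1 \/ kdo s.1 = 3 -> kdo t.1 = 1 \/ kdo t.1 = 3 ->
  bq s = bq t -> s.2 = t.2 -> t = s \/ t = mt s.
Proof.
case: s t => [o z] [o' z'] /= H H' E <-.
have [Eo _] := len1_slot (len_kd H); have [Eo' _] := len1_slot (len_kd H').
move: E => /(congr1 (@syl m len)); rewrite /bq /mt /= -!/(kdo _).
case: H => ->; case: H' => -> /= E.
- by left; rewrite Eo Eo' (ordS_inj E).
- by right; rewrite {1}Eo' E ord_predK.
- by right; rewrite {1}Eo' -(ordSK (syl o')) -E.
- by left; rewrite Eo Eo' -(ord_predK (syl o)) E ord_predK.
Qed.

Lemma bp_bq s : bp s = fs (ordS (ordS (syl (bq s)))).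
Proof. by rewrite /bp /bq syl_fst; case: ifP => // _; rewrite ord_predK. Qed.

Lemma polygonal_circuits (w : freegroup 2) (k0 : 'I_m) :
  fgval w = sylword c len -> kd k0 = 0 -> polygonal w.
Proof.
move=> wE k00.
have alt k : (c (ordS k)).1 != (c k).1.
  case: (kd_cases k) (kdS k) => E; rewrite E /=.
  - by move=> /c1 ->; rewrite (c0 E) eq_sym.
  - by move=> /c2 ->; rewrite (c1 E).
  - by move=> /c3 ->; rewrite (c2 E) eq_sym.
  - by move=> /c0 ->; rewrite (c3 E).
have inD o : (o, (fs k0, (Ordinal n0_gt0, true))) \in dom by rewrite !inE /kdo /= k00.
apply: (@polygonal_gluing _ w _ _ dom nxt prv mt (fun s => slot_pos c s.1) lab ori V).
- by rewrite /cyclically_reduced wE; apply: sylword_cycle.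
- by move=> [o z]; rewrite !inE; apply: step_dom.
- exact: mt_dom.
- exact: nxtK.
- by move=> s _; rewrite wE; apply: slot_pos_lt.
- by move=> s _; rewrite wE; apply: slot_pos_nx.
- by move=> s x0; rewrite wE; apply: slabE.
- exact: mtK.
- exact: mt_neq.
- move=> s sD; case: (kdo_cases s.1) => H.
    by rewrite !lab_a //; apply: kd_mt_a.
  by rewrite !lab_b //; case: (kd_mt_b H).
- move=> g s sD; case: (kdo_cases s.1) => H.
    rewrite (ends_a g sD H).1 (ends_a g (mt_dom sD) (kd_mt_a sD H)).1.
    by rewrite edge_mt.
  have [H' E1 E2 E3] := kd_mt_b H.
  by rewrite (ends_b g H).1 (ends_b g H').1 E1 E3.
- move=> g s sD; case: (kdo_cases s.1) => H.
    rewrite (ends_a g sD H).2 (ends_a g (mt_dom sD) (kd_mt_a sD H)).2.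
    by rewrite edge_mt.
  have [H' E1 E2 E3] := kd_mt_b H.
  by rewrite (ends_b g H).2 (ends_b g H').2 E2 E3.
- move=> s t sD tD; case: (kdo_cases s.1) => H; case: (kdo_cases t.1) => H'.
  + rewrite (ends_a _ sD H).1 (ends_a _ tD H').1 => _ /etail_inj.
    exact: edge_inj.
  + by rewrite (lab_a H) (lab_b H') => /eqP; rewrite (negbTE ab).
  + by rewrite (lab_b H) (lab_a H') => /esym /eqP; rewrite (negbTE ab).
  + rewrite (ends_b _ H).1 (ends_b _ H').1 => _ /(vq_inj sD tD H H')[].
    exact: bq_inj.
- move=> s t sD tD; case: (kdo_cases s.1) => H; case: (kdo_cases t.1) => H'.
  + rewrite (ends_a _ sD H).2 (ends_a _ tD H').2 => _ /ehead_inj.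
    exact: edge_inj.
  + by rewrite (lab_a H) (lab_b H') => /eqP; rewrite (negbTE ab).
  + by rewrite (lab_b H) (lab_a H') => /esym /eqP; rewrite (negbTE ab).
  + rewrite (ends_b _ H).2 (ends_b _ H').2 !bp_bq => _ E.
    have EF : F s.2 = F t.2 := congr1 (fun v : vertex_name => v.2.2) E.
    have := congr1 (fun v : vertex_name => syl v.2.1) E; rewrite /vp !syl_fst.
    move=> /ordS_inj /ordS_inj {}E; apply: bq_inj => //.
      by rewrite /bq E.
    by rewrite -(FK sD) EF FK.
(* At the head of this [b]-edge one side turns into the inverse of a [p]-letter and its mate into a
   [p]-letter. *)
exists (fs (ordS k0), (fs k0, (Ordinal n0_gt0, true))); first exact: inD.
have k1 : kd (ordS k0) = 1 by rewrite kdS k00.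
rewrite /head_turn !fwd_lab /mt /kdo !syl_fst k1 !syl_fst /= !kdS k00 /=.
have Ep : pv (fs (ordS k0)) = ls k0 by rewrite pv_fst ordSK.
have En : nx (fs (ordS (ordS (ordS k0)))) = fs (ordS (ordS (ordS (ordS k0)))).
  have /len1_slot [_ ->] : len (syl (fs (ordS (ordS (ordS k0))))) = 1.
    by rewrite syl_fst len3 // !kdS k00.
  by rewrite nx_lst.
rewrite /lab /prv /nxt /= Ep En !syl_fst syl_lst.
rewrite (c0 k00) c0 /linv /=; last by rewrite !kdS k00.
by rewrite xpair_eqE eqxx; case: sp.
Qed.

End HeightOne.

Lemma polygonal_height_one (w : freegroup 2) (m : nat) (c : 'I_m -> letter 2)
    (len : 'I_m -> nat) (a b : 'I_2) (sp sq sb : bool) (kd : 'I_m -> nat) (k0 : 'I_m) :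
    (forall k, 0 < len k) -> a != b ->
    (forall k, kd k < 4) -> (forall k, kd (ordS k) = (kd k).+1 %% 4) ->
    (forall k, kd k = 0 -> c k = (a, sp)) -> (forall k, kd k = 1 -> c k = (b, ~~ sb)) ->
    (forall k, kd k = 2 -> c k = (a, sq)) -> (forall k, kd k = 3 -> c k = (b, sb)) ->
    (forall k, kd k = 1 -> len k = 1) -> (forall k, kd k = 3 -> len k = 1) ->
    fgval w = sylword c len -> kd k0 = 0 ->
    \sum_(k | kd k == 0) len k <= \sum_(k | kd k == 2) len k ->
    \sum_(k | (kd k == 2) && (len k == 1)) len k <= \sum_(k | kd k == 0) len k ->
  polygonal w.
Proof.
move=> len_gt0 ab kd_lt kdS c0 c1 c2 c3 len1 len3 wE k00.
have cardE (A : pred 'I_m) : \sum_(k | A k) len k = #|[pred o : slot len | A (syl o)]|.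
  rewrite -sum1_card (eq_bigr (fun k => \sum_(j < len k) 1)); last first.
    by move=> k _; rewrite sum1_card card_ord.
  by rewrite sig_big_dep; apply: eq_bigl => o; rewrite andbT.
rewrite !cardE.
set P := #|_|; set Q := #|_|; set Q1 := #|_| => PQ Q1P.
pose Q2 := #|[pred o : slot len | (kd (syl o) == 2) && (len (syl o) != 1)]|.
have QE : Q = Q1 + Q2.
  rewrite /Q -(cardID [pred o : slot len | len (syl o) == 1]); congr (_ + _);
  by apply: eq_card => o; rewrite !inE // andbC.
have P_gt0 : 0 < P by apply/card_gt0P; exists (fst_ len_gt0 k0); rewrite inE /= k00.
(* If no [q]-syllable is longer than one letter, the inequalities force [P = Q1]. Otherwise
   [n0 = Q2] and [beta = P - Q1] solve the equation, and [beta <= n0] says [P <= Q1 + Q2]. *)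
have [n0 [beta [n0_gt0 beta_le bal]]] :
    exists n0 beta, [/\ 0 < n0, beta <= n0 & P * n0 = Q1 * n0 + Q2 * beta].
  case: (posnP Q2) => Q20; first by exists 1, 0; split=> //; lia.
  exists Q2, (P - Q1); split=> //; [lia | nia].
have [F [G [F_in G_in FK GK]]] :=
  card_bijection (card_idx (len := len) (kd := kd) beta_le bal).
exact: (polygonal_circuits len_gt0 ab kd_lt kdS c0 c1 c2 c3 len1 len3 n0_gt0 F_in G_in FK GK wE k00).
Qed.

(** * From words to syllables *)

Section Blocks.
Variables (l s : nat).
Hypothesis s_gt0 : 0 < s.

Lemma quo_proof (k : 'I_(l * s)) : k %/ s < l.
Proof. by rewrite ltn_divLR. Qed.
Definition quo k : 'I_l := Ordinal (quo_proof k).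

Lemma mod_ordS (k : 'I_(l * s)) : ordS k %% s = (k %% s).+1 %% s.
Proof. by rewrite /= modn_dvdm ?dvdn_mull // -addn1 -[in RHS]addn1 modnDml. Qed.

Lemma quo_ordS k : quo (ordS k) = if (k %% s).+1 < s then quo k else ordS (quo k).
Proof.
have E := divn_eq k s; have lt := ltn_pmod k s_gt0; apply: val_inj.
case: ltnP => [lt' | ge] /=.
  rewrite modn_small; last first.
    by rewrite E -addnS (leq_trans (n := (k %/ s).+1 * s)) ?mulSnr ?ltn_add2l // -mulSnr leq_mul2r quo_proof orbT.
  by rewrite {1}E -addnS divnMDl // (divn_small lt') addn0.
have -> : k.+1 = (k %/ s).+1 * s.
  by rewrite {1}E -addnS mulSnr; congr (_ + _); apply/eqP; rewrite eqn_leq lt.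
by rewrite -muln_modl mulnK.
Qed.

Lemma block_pairs : [seq (quo k, k %% s) | k <- enum 'I_(l * s)] =
  [seq (i, j) | i <- enum 'I_l, j <- iota 0 s].
Proof.
apply: (@inj_map _ _ (fun u : 'I_l * nat => (val u.1, u.2))).
  by move=> [i j] [i' j'] /= [E ->]; congr (_, _); apply: val_inj.
rewrite -map_comp map_allpairs /=.
have -> : [seq (val i, j) | i <- enum 'I_l, j <- iota 0 s] = [seq (i, j) | i <- iota 0 l, j <- iota 0 s].
  by rewrite -(val_enum_ord l) allpairs_mapl.
rewrite (map_comp (fun k => (k %/ s, k %% s)) val) val_enum_ord.
elim: l => [|l' IH].
  by rewrite mul0n.
rewrite mulSnr iotaD map_cat IH -[l'.+1]addn1 iotaD allpairs_cat /= cats0; congr (_ ++ _).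
rewrite add0n -[l' * s]addn0 iotaDl -map_comp; apply/eq_in_map => j; rewrite mem_iota /= add0n => lt.
by rewrite divnMDl // divn_small // addn0 modnMDl modn_small.
Qed.

(** Stated for any monoid law, to serve both sums and concatenations. *)
Lemma big_blocks (R : Type) (idx : R) (op : Monoid.law idx) (F : 'I_l -> nat -> R) :
  \big[op/idx]_(k <- enum 'I_(l * s)) F (quo k) (k %% s) =
  \big[op/idx]_(i <- enum 'I_l) \big[op/idx]_(j <- iota 0 s) F i j.
Proof.
transitivity (\big[op/idx]_(u <- [seq (quo k, k %% s) | k <- enum 'I_(l * s)]) F u.1 u.2).
  by rewrite big_map.
by rewrite block_pairs big_allpairs.
Qed.

Lemma sum_blocks (R : nmodType) (F : 'I_l -> nat -> R) :
  (\sum_(k < l * s) F (quo k) (k %% s)%N = \sum_(i < l) \sum_(j <- iota 0 s) F i j)%R.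
Proof. by have := big_blocks +%R F; rewrite !big_enum. Qed.

Lemma sylword_blocks n (x : 'I_l -> nat -> letter n) (len : 'I_l -> nat -> nat) :
  sylword (fun k => x (quo k) (k %% s)) (fun k => len (quo k) (k %% s)) =
  flatten [seq flatten [seq nseq (len i j) (x i j) | j <- iota 0 s] | i <- enum 'I_l].
Proof.
have flE (I : Type) (r : seq I) (f : I -> seq (letter n)) :
    flatten [seq f i | i <- r] = \big[cat/[::]]_(i <- r) f i.
  by elim: r => [|i r IH]; rewrite ?big_nil // big_cons /= IH.
rewrite /sylword !flE (big_blocks cat (fun i j => nseq (len i j) (x i j))).
by apply: eq_bigr => i _; rewrite flE.
Qed.

End Blocks.

Lemma fgval_prod n l (u : 'I_l -> freegroup n) (B : 'I_l -> seq (letter n)) :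
    (forall i, reduced (B i) -> fgval (u i) = B i) ->
    reduced (flatten [seq B i | i <- enum 'I_l]) ->
  fgval (\prod_(i < l) u i)%g = flatten [seq B i | i <- enum 'I_l].
Proof.
move=> uE; have -> : (\prod_(i < l) u i = \prod_(i <- enum 'I_l) u i)%g by rewrite enumT [index_enum _]unlock.
elim: (enum 'I_l) => [|i r IH] /=; first by rewrite big_nil.
move=> red; have [rB rr] := cat_sorted2 red; rewrite big_cons fgval_mul ?uE ?IH //.
Qed.

Definition psgn (z : int) : bool := (0 <= z)%R.
Definition bsign (x : bool) : int := if x then 1%R else (-1)%R.

Lemma sgz_psgn z : z <> 0%R -> sgz z = bsign (psgn z).
Proof. by case: z => [[|k]|k]. Qed.

Lemma fgval_zpow_gen n (g : 'I_n) (z : int) :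
  fgval (zpow (gen g) z) = nseq `|z|%N (g, psgn z).
Proof.
have E k : fgval (gen g ^+ k)%g = nseq k (g, true).
  rewrite fgval_expg; last by rewrite /cyclically_reduced /= /nocancel /linv xpair_eqE andbF.
  by elim: k => //= k ->.
case: z => k; rewrite /zpow; first by rewrite E.
have -> : fgval (gen g ^- k.+1)%g = winv (fgval (gen g ^+ k.+1)%g) by [].
by rewrite E /winv map_nseq rev_nseq.
Qed.

Import GRing.Theory Num.Theory.

(** * The gluing criteria expressed by syllables *)

Section SyllableWords.
Variables (w : freegroup 2) (m : nat) (c : 'I_m -> letter 2) (len : 'I_m -> nat).
Hypothesis len_gt0 : forall k, 0 < len k.
Hypothesis alt : forall k, (c (ordS k)).1 != (c k).1.
Hypothesis wE : fgval w = sylword c len.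

Local Notation O := (slot len).
Local Notation fs := (fst_ len_gt0).
Local Notation ls := (lst len_gt0).
Local Notation nx := (nx len_gt0).
Local Notation pv := (pv len_gt0).

Lemma w_cycle : cyclically_reduced w.
Proof. by rewrite /cyclically_reduced wE; apply: sylword_cycle. Qed.

Lemma brk_slab o : brk nx (slab c (len := len)) o = (o == ls (syl o)).
Proof. by rewrite /brk slab_nx_gen // negbK. Qed.

Lemma brk_len1 o : brk nx (slab c (len := len)) o && brk nx (slab c (len := len)) (pv o) = (len (syl o) == 1).
Proof.
rewrite !brk_slab; apply/andP/eqP => [[/eqP E /eqP E'] | E].
  have : o = fs (syl o).
    by rewrite -[o in RHS](pvK len_gt0) E' nx_lst syl_fst -nx_lst -E' pvK.
  by move/eqP; rewrite {1}E eq_sym fst_lst => /eqP.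
have E1 := slot_len1 len_gt0 E; rewrite {1 3 4}E1 pv_fst eqxx; split=> //.
by rewrite {1}E1 fst_lst E.
Qed.

Lemma polygonal_long_syllables (k0 : 'I_m) : (forall k, 1 < len k) -> polygonal w.
Proof.
move=> len_gt1.
apply: (@polygonal_long O nx pv (slab c (len := len)) (nxK len_gt0) (pvK len_gt0)
  (slab_nocancel len_gt0 alt) w (slot_pos c (len := len)) w_cycle).
- by move=> o; rewrite wE; apply: slot_pos_lt.
- by move=> o; rewrite wE; apply: slot_pos_nx.
- by move=> o x0; rewrite wE; apply: slabE.
- by move=> o; rewrite brk_len1 neq_ltn len_gt1 orbT.
by exists (ls k0); rewrite brk_slab.
Qed.

Lemma card_sign (A h : pred 'I_m) : (\sum_(k | A k) bsign (h k) = 0)%R ->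
  #|[pred k | A k && h k]| = #|[pred k | A k && ~~ h k]|.
Proof.
rewrite (bigID h) /= => E; apply/eqP; rewrite -(eqr_nat int) -subr_eq0 -{}E; apply/eqP.
rewrite -!sum1_card !natr_sum -sumrN; congr (_ + _)%R; apply: eq_bigr => k /andP[_].
  by rewrite /bsign => ->.
by rewrite /bsign => /negbTE ->.
Qed.

(** The single sum over consecutive syllables suffices for both balances, at the tails and at the
    heads of the isolated letters, because a second relation holds for free. *)
Lemma polygonal_isolated_syllables (g : 'I_2) (k0 : 'I_m) :
    (forall k, (c k).1 = g -> 1 < len k) -> (forall k, (c k).1 != g -> len k = 1) ->
    (\sum_k bsign (c k).2 * bsign (c (ordS k)).2 = 0)%R ->
  polygonal w.
Proof.
move=> long iso balS.
pose B k := (c k).1 != g.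
have gS k : ((c (ordS k)).1 == g) = B k.
  apply/eqP/idP => [E | kg]; first by rewrite /B -E eq_sym.
  by apply: (@gen2P (c k).1); rewrite // eq_sym.
have gP k : ((c (ord_pred k)).1 == g) = B k.
  by have := gS (ord_pred k); rewrite ord_predK /B => ->; rewrite negbK.
(* [h1] and [h2] tell whether the neighbouring [g]-edge at the tail, respectively the head, of the
   isolated letter [k] has its own head there. *)
pose h1 k := if (c k).2 then (c (ord_pred k)).2 else ~~ (c (ordS k)).2.
pose h2 k := if (c k).2 then ~~ (c (ordS k)).2 else (c (ord_pred k)).2.
have bal : (\sum_(k | B k) bsign (c k).2 * (bsign (c (ord_pred k)).2 + bsign (c (ordS k)).2) = 0)%R.
  apply: etrans balS; rewrite [RHS](bigID B) /=.
  have -> : (\sum_(k | ~~ B k) bsign (c k).2 * bsign (c (ordS k)).2 =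
             \sum_(k | B k) bsign (c (ord_pred k)).2 * bsign (c k).2)%R.
    rewrite [LHS](reindex_inj (@ord_pred_inj m)); apply: eq_big => k; last first.
      by rewrite ord_predK.
    by rewrite {1}/B negbK gP.
  rewrite -big_split; apply: eq_bigr => k _ /=.
  by rewrite mulrDr addrC [(bsign (c k).2 * bsign (c (ord_pred k)).2)%R]mulrC.
have next_prev : (\sum_(k | B k) bsign (c (ord_pred k)).2 = \sum_(k | B k) bsign (c (ordS k)).2)%R.
  transitivity (\sum_(k | (c k).1 == g) bsign (c k).2)%R.
    by rewrite [RHS](reindex_inj (@ord_pred_inj m)); apply: eq_bigl => k; rewrite gP.
  by rewrite [LHS](reindex_inj (@ordS_inj m)); apply: eq_bigl => k; rewrite gS.
have [sum1 sum2] : (\sum_(k | B k) bsign (h1 k) = 0 /\ \sum_(k | B k) bsign (h2 k) = 0)%R.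
  (* The free relation: every [g]-syllable precedes one isolated letter and follows one, so the
     signs cancel. *)
  have E1 : (\sum_(k | B k) bsign (h1 k) + \sum_(k | B k) bsign (h2 k) = 0)%R.
    transitivity (\sum_(k | B k) (bsign (c (ord_pred k)).2 - bsign (c (ordS k)).2))%R.
      rewrite -big_split; apply: eq_bigr => k _; rewrite /h1 /h2 /=.
      by case: (c k).2; case: (c _).2; case: (c _).2.
    by rewrite big_split sumrN /= next_prev subrr.
  (* The difference is the hypothesis, regrouped around the isolated letters. *)
  have E2 : (\sum_(k | B k) bsign (h1 k) - \sum_(k | B k) bsign (h2 k) = 0)%R.
    apply: etrans bal; rewrite -sumrN -big_split; apply: eq_bigr => k _; rewrite /h1 /h2 /=.
    by case: (c k).2; case: (c _).2; case: (c _).2.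
  by move: E1 E2; move: (\sum_(k | B k) _)%R (\sum_(k | B k) _)%R => u v; lia.
have fsls k : B k -> fs k = ls k by move=> /iso E; apply/eqP; rewrite fst_lst E.
have transfer (H : pred O) (h : pred 'I_m) : (forall k, B k -> H (fs k) = h k) ->
    #|[pred o : O | ((slab c o).1 != g) && H o]| = #|[pred k | B k && h k]|.
  move=> Hh; have fs_inj : injective (fst_ len_gt0) by move=> i j /(congr1 (@syl m len)).
  rewrite -(card_image fs_inj [pred k | B k && h k]); apply: eq_card => o.
  rewrite !inE; apply/idP/imageP => [/andP[Bo Ho] | [k /andP[Bk hk] ->]].
    have Eo := slot_len1 len_gt0 (iso _ Bo); exists (syl o) => //.
    by rewrite inE [B _]Bo -Hh // -Eo.
  by rewrite [_ != g]Bk Hh.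
have head_self k : B k -> has_head nx (slab c (len := len)) g (ls k) = ~~ (c (ordS k)).2.
  move=> Bk; rewrite /has_head nx_lst /slab syl_fst syl_lst -!pair_eqE /pair_eq /=.
  by rewrite (negbTE (Bk : (c k).1 != g)) gS Bk /= eqbF_neg.
have head_pred k : B k -> has_head nx (slab c (len := len)) g (ls (ord_pred k)) = (c (ord_pred k)).2.
  move=> Bk; rewrite /has_head nx_lst ord_predK /slab syl_fst syl_lst -!pair_eqE /pair_eq /=.
  by rewrite (negbTE (Bk : (c k).1 != g)) gP Bk /= orbF eqb_id.
have tcE k : B k -> has_head nx (slab c (len := len)) g (tc pv (slab c (len := len)) (fs k)) = h1 k.
  move=> Bk; rewrite /tc /h1 -[slab c (fs k)]/(c k); case: ifP => _; first by rewrite pv_fst head_pred.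
  by rewrite fsls // head_self.
have hcE k : B k -> has_head nx (slab c (len := len)) g (hc pv (slab c (len := len)) (fs k)) = h2 k.
  move=> Bk; rewrite /hc /h2 -[slab c (fs k)]/(c k); case: ifP => _; last by rewrite pv_fst head_pred.
  by rewrite fsls // head_self.
apply: (@polygonal_isolated O nx pv (slab c (len := len)) (nxK len_gt0) (pvK len_gt0)
  (slab_nocancel len_gt0 alt) w (slot_pos c (len := len)) w_cycle _ _ _ g).
- by move=> o; rewrite wE; apply: slot_pos_lt.
- by move=> o; rewrite wE; apply: slot_pos_nx.
- by move=> o x0; rewrite wE; apply: slabE.
- by move=> o og; rewrite brk_len1 neq_ltn long ?orbT.
- by move=> o og; rewrite brk_len1 iso.
- rewrite (transfer _ h1) // (transfer _ (fun k => ~~ h1 k)); first exact: card_sign.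
  by move=> k /tcE ->.
- rewrite (transfer _ h2) // (transfer _ (fun k => ~~ h2 k)); first exact: card_sign.
  by move=> k /hcE ->.
by exists (ls k0); rewrite brk_slab.
Qed.

End SyllableWords.

Section Product.
Variables (n l s : nat) (x : 'I_l -> nat -> letter n) (len : 'I_l -> nat -> nat).
Hypothesis s_gt0 : 0 < s.

Let cc (k : 'I_(l * s)) := x (quo s_gt0 k) (k %% s).
Let ll (k : 'I_(l * s)) := len (quo s_gt0 k) (k %% s).

(** Alternating generators make the concatenated word reduced, so nothing cancels between the
    factors. *)
Lemma fgval_prod_syllables (u : 'I_l -> freegroup n) :
    (forall k, 0 < ll k) -> (forall k, (cc (ordS k)).1 != (cc k).1) ->
    (forall i, let B := flatten [seq nseq (len i j) (x i j) | j <- iota 0 s] in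
      reduced B -> fgval (u i) = B) ->
  fgval (\prod_(i < l) u i)%g = sylword cc ll.
Proof.
move=> ll_gt0 alt uE; have := sylword_cycle ll_gt0 alt.
rewrite sylword_blocks => cyc; apply: fgval_prod => //.
by case: (flatten _) cyc => //= y r; rewrite rcons_path => /andP[].
Qed.

Lemma ccS k : cc (ordS k) =
  x (if (k %% s).+1 < s then quo s_gt0 k else ordS (quo s_gt0 k)) ((k %% s).+1 %% s).
Proof. by rewrite /cc quo_ordS mod_ordS. Qed.

End Product.

(** * The four families of words *)

Section Words.
Variables (l : nat) (p q : 'I_l -> int).
Hypothesis hl : 0 < l.
Hypotheses (hp : forall i, p i <> 0%R) (hq : forall i, q i <> 0%R).

Definition syl2 (i : 'I_l) (j : nat) : letter 2 :=
  if j is 0 then (ord0, psgn (p i)) else (ord_max, psgn (q i)).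
Definition len2 (i : 'I_l) (j : nat) : nat := if j is 0 then `|p i| else `|q i|.
Definition syl4 (i : 'I_l) (j : nat) : letter 2 :=
  match j with
  | 0 => (ord0, psgn (p i)) | 1 => (ord_max, false)
  | 2 => (ord0, psgn (q i)) | _ => (ord_max, true)
  end.
Definition len4 (i : 'I_l) (j : nat) : nat :=
  match j with 0 => `|p i| | 2 => `|q i| | _ => 1 end.

Definition c2 (k : 'I_(l * 2)) := syl2 (quo (isT : 0 < 2) k) (k %% 2).
Definition l2 (k : 'I_(l * 2)) := len2 (quo (isT : 0 < 2) k) (k %% 2).
Definition c4 (k : 'I_(l * 4)) := syl4 (quo (isT : 0 < 4) k) (k %% 4).
Definition l4 (k : 'I_(l * 4)) := len4 (quo (isT : 0 < 4) k) (k %% 4).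

Lemma mod2P k : k %% 2 = 0 \/ k %% 2 = 1.
Proof. by have := ltn_pmod k (isT : 0 < 2); case: (k %% 2) => [|[]] //; auto. Qed.

Lemma mod4P k : [\/ k %% 4 = 0, k %% 4 = 1, k %% 4 = 2 | k %% 4 = 3].
Proof.
by have := ltn_pmod k (isT : 0 < 4); case: (k %% 4) => [|[|[|[]]]] // _;
  [apply: Or41 | apply: Or42 | apply: Or43 | apply: Or44].
Qed.

Lemma absz_p_gt0 i : 0 < `|p i|. Proof. by rewrite absz_gt0; apply/eqP. Qed.
Lemma absz_q_gt0 i : 0 < `|q i|. Proof. by rewrite absz_gt0; apply/eqP. Qed.

Lemma l2_gt0 k : 0 < l2 k.
Proof. by rewrite /l2; case: (mod2P k) => -> /=; rewrite ?absz_p_gt0 ?absz_q_gt0. Qed.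

Lemma l4_gt0 k : 0 < l4 k.
Proof. by rewrite /l4; case: (mod4P k) => -> //=; rewrite ?absz_p_gt0 ?absz_q_gt0. Qed.

Lemma c2_alt k : (c2 (ordS k)).1 != (c2 k).1.
Proof. by rewrite /c2 ccS; case: (mod2P k) => ->. Qed.

Lemma c4_alt k : (c4 (ordS k)).1 != (c4 k).1.
Proof. by rewrite /c4 ccS; case: (mod4P k) => ->. Qed.

Lemma word2E :
  fgval (\prod_(i < l) (zpow fa (p i) * zpow fb (q i)))%g = sylword c2 l2.
Proof.
apply: fgval_prod_syllables; [exact: l2_gt0 | exact: c2_alt | move=> i B].
by rewrite {}/B [flatten _]/= cats0 => r; rewrite fgval_mul !fgval_zpow_gen.
Qed.

Lemma word4E :
  fgval (\prod_(i < l) (zpow fa (p i) * (zpow fa (q i)) ^ fb))%g = sylword c4 l4.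
Proof.
apply: fgval_prod_syllables; [exact: l4_gt0 | exact: c4_alt | move=> i B].
rewrite {}/B [flatten _]/= => r.
have fbV : fgval fb^-1%g = [:: (ord_max, false)] by [].
have [_ r1] := cat_sorted2 r; have r2 := path_sorted r1.
have E1 : fgval (zpow fa (q i) * fb)%g = nseq `|q i| (ord0, psgn (q i)) ++ [:: (ord_max, true)].
  by rewrite fgval_mul fgval_zpow_gen.
have E2 : fgval ((zpow fa (q i)) ^ fb)%g =
    (ord_max, false) :: nseq `|q i| (ord0, psgn (q i)) ++ [:: (ord_max, true)].
  by rewrite conjgE fgval_mul E1.
by rewrite fgval_mul E2 fgval_zpow_gen.
Qed.

Lemma k0_proof s : 0 < s -> 0 < l * s. Proof. by move=> s0; rewrite muln_gt0 hl. Qed.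

Lemma polygonal_part1 : (forall i, 1 < `|p i|) -> (forall i, 1 < `|q i|) ->
  polygonal (\prod_(i < l) (zpow fa (p i) * zpow fb (q i)))%g.
Proof.
move=> p1 q1.
apply: (polygonal_long_syllables l2_gt0 c2_alt word2E (Ordinal (k0_proof (isT : 0 < 2)))).
by move=> k; rewrite /l2; case: (mod2P k) => -> /=.
Qed.

Lemma polygonal_part2 : (forall i, 1 < `|p i|) -> (forall i, `|q i| = 1) ->
    (\sum_(i < l) (sgz (p i * q i) + sgz (p (ordS i) * q i)) = 0)%R ->
  polygonal (\prod_(i < l) (zpow fa (p i) * zpow fb (q i)))%g.
Proof.
move=> p1 q1 bal.
apply: (polygonal_isolated_syllables l2_gt0 c2_alt word2E (g := ord0)
  (Ordinal (k0_proof (isT : 0 < 2)))).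
- by move=> k; rewrite /c2 /l2; case: (mod2P k) => -> /=.
- by move=> k; rewrite /c2 /l2; case: (mod2P k) => -> /=.
apply: etrans bal.
pose F i j := (bsign (syl2 i j).2 * bsign (syl2 (if (j.+1 < 2)%N then i else ordS i) (j.+1 %% 2)%N).2)%R.
rewrite (eq_bigr (fun k : 'I_(l * 2) => F (quo (isT : 0 < 2) k) (k %% 2)));
  last by move=> k _; rewrite /c2 ccS.
rewrite sum_blocks; apply: eq_bigr => i _; rewrite /F.
rewrite !big_cons big_nil /= addr0 !sgzM !sgz_psgn //; congr (_ + _)%R.
by rewrite mulrC.
Qed.

Lemma polygonal_part3 : (forall i, 1 < `|p i|) -> (forall i, 1 < `|q i|) ->
  polygonal (\prod_(i < l) (zpow fa (p i) * (zpow fa (q i)) ^ fb))%g.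
Proof.
move=> p1 q1.
apply: (polygonal_isolated_syllables l4_gt0 c4_alt word4E (g := ord0)
  (Ordinal (k0_proof (isT : 0 < 4)))).
- by move=> k; rewrite /c4 /l4; case: (mod4P k) => -> /=.
- by move=> k; rewrite /c4 /l4; case: (mod4P k) => -> /=.
pose F i j := (bsign (syl4 i j).2 * bsign (syl4 (if (j.+1 < 4)%N then i else ordS i) (j.+1 %% 4)%N).2)%R.
rewrite (eq_bigr (fun k : 'I_(l * 4) => F (quo (isT : 0 < 4) k) (k %% 4)));
  last by move=> k _; rewrite /c4 ccS.
rewrite sum_blocks.
(* In one block the signs of [p_i], [b^-1], [q_i], [b] and the next [p] contribute minus [p_i],
   minus [q_i], plus [q_i] and plus the next [p]; the sum telescopes cyclically. *)
transitivity (\sum_(i < l) (bsign (psgn (p (ordS i))) - bsign (psgn (p i))))%R.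
  apply: eq_bigr => i _; rewrite /F !big_cons big_nil /=.
  by case: (psgn (p i)); case: (psgn (q i)); case: (psgn _).
rewrite big_split sumrN /= [X in (_ - X)%R](reindex_inj (@ordS_inj l)).
by rewrite subrr.
Qed.

Lemma sum_kd (j0 : nat) (P : pred nat) : j0 < 4 ->
  \sum_(k : 'I_(l * 4) | (k %% 4 == j0) && P (l4 k)) l4 k = \sum_(i < l | P (len4 i j0)) len4 i j0.
Proof.
move=> lt_j0.
rewrite big_mkcond [RHS]big_mkcond.
rewrite (sum_blocks (isT : 0 < 4) (fun i j => if (j == j0) && P (len4 i j) then len4 i j else 0)).
apply: eq_bigr => i _; rewrite !big_cons big_nil.
by case: j0 lt_j0 => [|[|[|[]]]] // _ /=; rewrite ?(addr0, add0r).
Qed.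

Lemma polygonal_part4 :
    (forall i j, sgz (p i) = sgz (p j)) -> (forall i j, sgz (q i) = sgz (q j)) ->
    let P := \sum_(i < l) `|p i| in
    let Q := \sum_(i < l) `|q i| in
    let P' := #|[set i | `|p i| == 1]| in
    let Q' := #|[set i | `|q i| == 1]| in
    P * P' <= Q ^ 2 -> Q * Q' <= P ^ 2 ->
  polygonal (\prod_(i < l) (zpow fa (p i) * (zpow fa (q i)) ^ fb))%g.
Proof.
move=> sp sq P Q P' Q' PQ QP.
pose i0 := Ordinal hl.
have same_sgn (z z' : int) : z <> 0%R -> z' <> 0%R -> sgz z = sgz z' -> psgn z = psgn z'.
  by move=> z0 z0'; rewrite !sgz_psgn // /bsign; case: psgn; case: psgn.
have spE i : psgn (p i) = psgn (p i0) by apply: same_sgn.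
have sqE i : psgn (q i) = psgn (q i0) by apply: same_sgn.
have P_gt0 : 0 < P by rewrite /P (bigD1 i0) //= addn_gt0 absz_p_gt0.
have Q_gt0 : 0 < Q by rewrite /Q (bigD1 i0) //= addn_gt0 absz_q_gt0.
have ones (f : 'I_l -> nat) : \sum_(i | f i == 1) f i = #|[set i | f i == 1]|.
  by rewrite -sum1_card; apply: eq_big => i; rewrite ?inE // => /eqP.
have S0 : \sum_(k : 'I_(l * 4) | k %% 4 == 0) l4 k = P.
  by rewrite -[RHS](sum_kd xpredT (isT : 0 < 4)); apply: eq_bigl => k; rewrite andbT.
have S2 : \sum_(k : 'I_(l * 4) | k %% 4 == 2) l4 k = Q.
  by rewrite -[RHS](sum_kd xpredT (isT : 2 < 4)); apply: eq_bigl => k; rewrite andbT.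
have S0' : \sum_(k : 'I_(l * 4) | (k %% 4 == 0) && (l4 k == 1)) l4 k = P'.
  by rewrite (sum_kd (pred1 1) (isT : 0 < 4)) /= ones.
have S2' : \sum_(k : 'I_(l * 4) | (k %% 4 == 2) && (l4 k == 1)) l4 k = Q'.
  by rewrite (sum_kd (pred1 1) (isT : 2 < 4)) /= ones.
have [le_PQ | /ltnW le_QP] := leqP P Q.
  apply: (@polygonal_height_one _ _ c4 l4 ord0 ord_max (psgn (p i0)) (psgn (q i0)) true
    (fun k => k %% 4) (Ordinal (k0_proof (isT : 0 < 4))) l4_gt0) => //.
  - by move=> k; rewrite ltn_mod.
  - by move=> k; apply: mod_ordS.
  - by move=> k E; rewrite /c4 E /= spE.
  - by move=> k E; rewrite /c4 E.
  - by move=> k E; rewrite /c4 E /= sqE.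
  - by move=> k E; rewrite /c4 E.
  - by move=> k E; rewrite /l4 E.
  - by move=> k E; rewrite /l4 E.
  - exact: word4E.
  - by rewrite S0 S2.
  - by rewrite S2' S0; nia.
(* The case [Q <= P]: kinds are shifted by two, so that the [q_i] play the part of the
   [p]-syllables. The pattern starts at index 2, and [b] and its inverse trade places, whence [sb]
   is [false]. *)
have kd2 (k : nat) j : ((k %% 4).+2 %% 4 == j) = (j < 4) && (k %% 4 == j.+2 %% 4).
  by case: (mod4P k) => ->; case: j => [|[|[|[|j]]]].
have lt2 : 2 < l * 4 by rewrite (leq_trans (_ : 2 < 1 * 4)) ?leq_mul2r.
apply: (@polygonal_height_one _ _ c4 l4 ord0 ord_max (psgn (q i0)) (psgn (p i0)) false
  (fun k => (k %% 4).+2 %% 4) (Ordinal lt2) l4_gt0) => //.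
- by move=> k; rewrite ltn_mod.
- by move=> k; rewrite mod_ordS; case: (mod4P k) => ->.
- by move=> k /eqP; rewrite kd2 => /eqP E; rewrite /c4 E /= sqE.
- by move=> k /eqP; rewrite kd2 => /eqP E; rewrite /c4 E.
- by move=> k /eqP; rewrite kd2 => /eqP E; rewrite /c4 E /= spE.
- by move=> k /eqP; rewrite kd2 => /eqP E; rewrite /c4 E.
- by move=> k /eqP; rewrite kd2 => /eqP E; rewrite /l4 E.
- by move=> k /eqP; rewrite kd2 => /eqP E; rewrite /l4 E.
- exact: word4E.
- rewrite (eq_bigl (fun k : 'I_(l * 4) => k %% 4 == 2)) => [|k]; last by rewrite kd2.
  by rewrite [leqRHS](eq_bigl (fun k : 'I_(l * 4) => k %% 4 == 0)) => [|k]; rewrite ?kd2 ?S0 ?S2.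
rewrite (eq_bigl (fun k : 'I_(l * 4) => (k %% 4 == 0) && (l4 k == 1))) => [|k]; last by rewrite kd2.
rewrite [leqRHS](eq_bigl (fun k : 'I_(l * 4) => k %% 4 == 2)) => [|k]; last by rewrite kd2.
by rewrite S0' S2; nia.
Qed.

End Words.

Theorem theorem1p2 (l : nat) (p q : 'I_l -> int) (hl : (0 < l)%N)
    (hp : forall i, p i <> 0%R) (hq : forall i, q i <> 0%R) :
  [/\
      (forall i, (1 < `|p i|)%N) -> (forall i, (1 < `|q i|)%N) ->
      polygonal (\prod_(i < l) (zpow fa (p i) * zpow fb (q i)))%g,
      (forall i, (1 < `|p i|)%N) -> (forall i, `|q i|%N = 1%N) ->
      (\sum_(i < l) (sgz (p i * q i) + sgz (p (ordS i) * q i)) = 0)%R ->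
      polygonal (\prod_(i < l) (zpow fa (p i) * zpow fb (q i)))%g,
      (forall i, (1 < `|p i|)%N) -> (forall i, (1 < `|q i|)%N) ->
      polygonal (\prod_(i < l) (zpow fa (p i) * (zpow fa (q i)) ^ fb))%g
    &
      (forall i j, sgz (p i) = sgz (p j)) ->
      (forall i j, sgz (q i) = sgz (q j)) ->
      let P := (\sum_(i < l) `|p i|)%N in
      let Q := (\sum_(i < l) `|q i|)%N in
      let P' := #|[set i | `|p i|%N == 1%N]| in
      let Q' := #|[set i | `|q i|%N == 1%N]| in
      (P * P' <= Q ^ 2)%N -> (Q * Q' <= P ^ 2)%N ->
      polygonal (\prod_(i < l) (zpow fa (p i) * (zpow fa (q i)) ^ fb))%g].
Proof.
split; [exact: polygonal_part1 | exact: polygonal_part2 | exact: polygonal_part3 |].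
exact: polygonal_part4.
Qed.
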